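(* Let $p>3$ be a prime and let $k\ge 2$ be an integer. If $$\frac{\varphi(p-1)}{W(p-1)\sqrt{p}}>k\,2^{k-1},$$ then $A+B\neq P_p$ for all subsets $A,B\subseteq\mathbb{F}_p$ with $|A|\ge 2$ and $|B|=k$.
   Context: $\mathbb{F}_p$ is the finite field with $p$ elements. $P_p$ denotes the set of primitive elements of $\mathbb{F}_p$, i.e. the generators of the cyclic group $\mathbb{F}_p^{\times}$. For $A,B\subseteq\mathbb{F}_p$, $A+B=\{a+b: a\in A,\ b\in B\}$. $\varphi$ is Euler's totient function, and for a positive integer $n$, $W(n)$ denotes the number of positive square-free divisors of $n$. *)

(* Defs.v *)
From HB Require Import structures.
From mathcomp Require Import all_boot all_order all_algebra.
Set Implicit Arguments. Unset Strict Implicit. Unset Printing Implicit Defensive.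
Import Order.TTheory GRing.Theory Num.Theory.

Definition squarefree (d : nat) : bool :=
  (0 < d) && all (fun q => logn q d == 1) (primes d).

Definition W (n : nat) : nat := count squarefree (divisors n).

Definition primitive_elts (p : nat) : {set 'F_p} :=
  [set x : 'F_p | (p.-1).-primitive_root x]%R.

Definition sumset (p : nat) (A B : {set 'F_p}) : {set 'F_p} :=
  [set a + b | a in A, b in B]%R.

(* Main.v *)
Require Import Defs.
From HB Require Import structures.
From mathcomp Require Import all_boot all_order all_algebra.
From mathcomp Require Import cyclic all_field ring zify.
Set Implicit Arguments. Unset Strict Implicit. Unset Printing Implicit Defensive.
Import Order.TTheory GRing.Theory Num.Theory.
Local Open Scope ring_scope.

(** Suppose A + B = P_p. For each b in B choose b' <> b in B, and let C be the set of the m <= k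
    differences b' - b. If some x in P_p has x + c a square or 0 for every c in C, then, writing
    x = a + b, the element x + (b' - b) = a + b' lies in A + B although it is not primitive.
    Such an x exists because, eta being the quadratic character and S ranging over the subsets of C,
      sum_(x in P_p) prod_(c in C) (1 + eta(x + c)) = sum_S sum_(x in P_p) prod_(c in S) eta(x + c),
    where the empty S gives phi(p-1) and a sieve over the prime divisors of p - 1 bounds the other terms
    by W(p-1) |S| sqrt p, through Weil's bound
      |sum_x chi(x) prod_(c in S) eta(x + c)| <= |S| sqrt p.
    Weil's bound comes from the L-function sum_h Lam(h) T^(deg h) over monic polynomials h, with
    Lam(h) = chi(h(0)) prod_c eta(h(c)): it is a polynomial of degree at most |S|, and by Newton's
    identities minus the n-th power sum of its inverse roots is the character sum S_n over F_{p^n}.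
    A Stepanov-Bombieri argument for the curves y^2 = prod_c (c - x z^(p-1)) over F_{p^2n}, averaged
    over x, gives S_2n = O(p^n), so all inverse roots have absolute value at most sqrt p. *)

(** * Newton identities and power sums *)

(** Newton's identities, the coefficient form of X E' = - E * sum_w w X / (1 - w X); induction on
    [s] avoids power series. *)
Lemma newton_prod (R : comNzRingType) (s : seq R) k :
  let E := \prod_(w <- s) (1 - w *: 'X) in
  E`_k.+1 *+ k.+1 = - \sum_(i < k.+1) (\sum_(w <- s) w ^+ i.+1) * E`_(k - i).
Proof.
move=> /=; elim: s k => [|w s IHs] k.
  rewrite !big_nil coef1 /= mul0rn big1 ?oppr0 // => i _.
  by rewrite big_nil mul0r.
rewrite !big_cons; set E := \prod_(w <- s) _ in IHs *.
have EE j : ((1 - w *: 'X) * E)`_j = E`_j - w * (if j is j'.+1 then E`_j' else 0).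
  by rewrite mulrBl mul1r -scalerAl coefB coefZ coefXM; case: j.
under eq_bigr => i _ do rewrite big_cons EE mulrBr !mulrDl.
rewrite EE !big_split /= sumrN big_split /=.
have S1 : \sum_(i < k.+1) (\sum_(w <- s) w ^+ i.+1) *
    (w * (if (k - i)%N is j'.+1 then E`_j' else 0)) = - (w * E`_k *+ k).
  rewrite big_ord_recr /= subnn !mulr0 addr0; case: k => [|k].
    by rewrite big_ord0 mulr0n oppr0.
  rewrite -mulrnAr IHs mulrN opprK mulr_sumr; apply: eq_bigr => i _.
  by have le_ik : (i <= k)%N by [rewrite -ltnS]; rewrite (subSn le_ik) mulrCA.
(* The powers of the new root w telescope against the factor 1 - w X. *)
have S2 : \sum_(i < k.+1) w ^+ i.+1 * E`_(k - i) - \sum_(i < k.+1) w ^+ i.+1 *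
    (w * (if (k - i)%N is j'.+1 then E`_j' else 0)) = w * E`_k.
  rewrite [X in X - _]big_ord_recl [X in _ - X]big_ord_recr /= subnn !mulr0 addr0 subn0 expr1.
  rewrite -addrA -sumrB big1 ?addr0 // => i _.
  rewrite /bump /= add1n [(k - i)%N](_ : _ = (k - i.+1).+1); last by rewrite -subSn // ltn_ord.
  by rewrite mulrA -exprSr subrr.
move/eqP: S2; rewrite subr_eq => /eqP ->; rewrite S1.
have /eqP := IHs k; rewrite -eqr_oppLR => /eqP <-.
rewrite mulrnBl (mulrS (w * _)).
have alg (x y z t : R) : x - (z + y) = - (z + t - x - (t - y)) by ring.
exact: alg.
Qed.

(** [s] lists the inverses of the roots of the polynomial with coefficients [L k]; 0 is not a root
    because [L 0 = 1]. *)
Lemma split_const1_poly (L : nat -> algC) m :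
    L 0%N = 1 -> (forall k, (m < k)%N -> L k = 0) ->
  exists2 s : seq algC, (size s <= m)%N &
    forall k, L k = (\prod_(w <- s) (1 - w *: 'X))`_k.
Proof.
move=> L0 Lm; pose P : {poly algC} := \poly_(k < m.+1) L k.
have PE k : P`_k = L k by rewrite coef_poly; case: ltnP => // /Lm.
have [r Pr] := closed_field_poly_normal P.
have nzP : P != 0 by apply: contra_eq_neq L0 => P0; rewrite -PE P0 coef0 eq_sym oner_eq0.
have szr : (size r <= m)%N.
  have := size_poly m.+1 L; rewrite -/P Pr size_scale ?lead_coef_eq0 //.
  by rewrite size_prod_XsubC.
have P00 : P.[0] = 1 by rewrite horner_coef0 PE.
exists [seq z^-1 | z <- r]; first by rewrite size_map.
move=> k; rewrite -PE; congr (_`_k); rewrite big_map.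
have r0 z : z \in r -> z != 0.
  move=> zr; apply: contra_eq_neq P00 => z0; rewrite Pr hornerZ -z0.
  rewrite [X in _ * X](_ : _ = 0) ?mulr0 ?z0 1?eq_sym ?oner_eq0 //; apply/eqP.
  by rewrite -[_ == 0]/(root _ 0) root_prod_XsubC -z0.
have PE2 : P = (lead_coef P * \prod_(z <- r) (- z)) *: \prod_(z <- r) (1 - z^-1 *: 'X).
  rewrite {1}Pr -scalerA; congr (_ *: _).
  rewrite -mul_polyC rmorph_prod /= -big_split /=; apply: eq_big_seq => z zr.
  rewrite mulrBr mulr1 -scalerAr mul_polyC scalerA mulrN mulVf ?r0 //.
  by rewrite scaleN1r opprK polyCN addrC.
rewrite {1}PE2; move: P00; rewrite {1}PE2 hornerZ horner_prod.
rewrite [X in _ * X]big1 ?mulr1 => [->|z _]; first by rewrite scale1r.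
by rewrite !hornerE subr0.
Qed.

(** Since [L 0 = 1], the recurrence determines [S n.+1] from earlier values, and minus the power
    sums of [s] solve it too. The cutoff [N] reflects that one finite field yields the recurrence
    only up to some degree. *)
Lemma newton_unique (s : seq algC) (L S : nat -> algC) N :
    (forall k, L k = (\prod_(w <- s) (1 - w *: 'X))`_k) ->
    (forall k, (k < N)%N -> L k.+1 *+ k.+1 = \sum_(i < k.+1) S i.+1 * L (k - i)%N) ->
  forall n, (n < N)%N -> S n.+1 = - \sum_(w <- s) w ^+ n.+1.
Proof.
move=> LE HS; elim/ltn_ind => n IHn nN.
have L0 : L 0%N = 1.
  rewrite LE -horner_coef0 horner_prod big1 // => w _; rewrite !hornerE.
  by rewrite subr0.
have /= := newton_prod s n; rewrite -LE HS // -sumrN !big_ord_recr /= subnn -LE L0.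
rewrite !mulr1; set a := (X in X + _ = _); set b := (X in _ = X + _).
suff -> : a = b by move/addrI.
by apply: eq_bigr => i _; rewrite IHn ?(ltn_trans _ nN) // mulNr LE.
Qed.

(** By Bernoulli's inequality the powers of a number above 1 are unbounded. *)
Lemma expr_bounded_le1 (x C : algC) : 0 <= x -> (forall n, x ^+ n <= C) -> x <= 1.
Proof.
move=> x0 xC; rewrite real_leNgt ?ger0_real ?ler01 //; apply/negP => x1.
have bern n : 1 + (x - 1) *+ n <= x ^+ n.
  elim: n => [|n IHn]; first by rewrite mulr0n addr0.
  rewrite exprS; apply: (@le_trans _ _ (x * (1 + (x - 1) *+ n))); last first.
    by rewrite ler_wpM2l.
  rewrite mulrDr mulr1 mulrS addrA [1 + _]addrC subrK lerD2l.
  by apply: ler_peMl; rewrite ?(ltW x1) // mulrn_wge0 // subr_ge0 (ltW x1).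
have xm : 0 < x - 1 by rewrite subr_gt0.
have C0 : 0 <= C by apply: le_trans (xC 0%N); rewrite expr0 ler01.
have /archi_boundP := divr_ge0 C0 (ltW xm); set n := Num.bound _.
rewrite ltr_pdivrMr // => Cn; have /(le_lt_trans (le_trans (bern n) (xC n))) := Cn.
by rewrite mulr_natl -subr_lt0 addrK ltr10.
Qed.

(** A fixed linear combination of successive even power sums isolates a nonzero multiple of w^(2n),
    so the powers of |w|^2 / q stay bounded. *)
Lemma power_sum_bound (s : seq algC) (C q : algC) n0 : 0 < q ->
    (forall n, (n0 <= n)%N -> `|\sum_(w <- s) w ^+ (n.*2)| <= C * q ^+ n) ->
  forall w, w \in s -> `|w| ^+ 2 <= q.
Proof.
move=> q0 sC w ws; have [->|wn0] := eqVneq w 0.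
  by rewrite normr0 expr0n ltW.
(* The weights are the coefficients of [l], which vanishes at the square of every element of [s]
   except at w^2. *)
pose t := rem (w ^+ 2) (undup [seq x ^+ 2 | x <- s]).
have Ut : uniq (undup [seq x ^+ 2 | x <- s]) by apply: undup_uniq.
pose l : {poly algC} := \prod_(u <- t) ('X - u%:P).
have lw : l.[w ^+ 2] != 0.
  by rewrite -[_ == 0]/(root _ _) root_prod_XsubC mem_rem_uniq // !inE eqxx.
have lx x : x \in s -> x ^+ 2 != w ^+ 2 -> l.[x ^+ 2] = 0.
  move=> xs xw; apply/eqP; rewrite -[_ == 0]/(root _ _) root_prod_XsubC.
  by rewrite mem_rem_uniq // !inE xw mem_undup /=; apply/mapP; exists x.
pose c := count (fun x => x ^+ 2 == w ^+ 2) s.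
have c0 : (0 < c)%N by rewrite -has_count; apply/hasP; exists w.
have key n : \sum_(i < size l) l`_i * \sum_(x <- s) x ^+ (n + i).*2 =
    c%:R * l.[w ^+ 2] * w ^+ n.*2.
  under eq_bigr do rewrite mulr_sumr.
  rewrite exchange_big /= /c -sum1_count natr_sum 2!mulr_suml [RHS]big_mkcond /=.
  apply: eq_big_seq => x xs.
  have -> : \sum_(i < size l) l`_i * x ^+ (n + i).*2 = x ^+ n.*2 * l.[x ^+ 2].
    rewrite horner_coef mulr_sumr; apply: eq_bigr => i _.
    by rewrite mulrCA doubleD exprD -!mul2n !exprM.
  case: eqVneq => [xw|/(lx x xs) ->]; last by rewrite mulr0.
  by rewrite -!mul2n !exprM xw mul1r mulrC.
pose C' := (\sum_(i < size l) `|l`_i| * (C * q ^+ i)) / `|c%:R * l.[w ^+ 2]|.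
have cl0 : 0 < `|c%:R * l.[w ^+ 2]| by rewrite normr_gt0 mulf_neq0 // pnatr_eq0 -lt0n.
have bnd n : (n0 <= n)%N -> (`|w| ^+ 2 / q) ^+ n <= C'.
  move=> n0n; rewrite /C' ler_pdivlMr // expr_div_n mulrAC ler_pdivrMr ?exprn_gt0 //.
  rewrite -exprM mul2n -normrX mulrC -normrM -key.
  apply: le_trans (ler_norm_sum _ _ _) _; rewrite mulr_suml.
  apply: ler_sum => i _; rewrite normrM -mulrA ler_wpM2l //.
  by rewrite -mulrA -exprD [(i + n)%N]addnC; apply: sC; rewrite (leq_trans n0n) ?leq_addr.
have x0 : 0 < `|w| ^+ 2 / q by rewrite divr_gt0 // exprn_gt0 // normr_gt0.
have : `|w| ^+ 2 / q <= 1.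
  apply: (@expr_bounded_le1 _ (C' / (`|w| ^+ 2 / q) ^+ n0)); first exact: ltW.
  move=> n; rewrite ler_pdivlMr ?exprn_gt0 // -exprD; apply: bnd.
  exact: leq_addl.
by rewrite ler_pdivrMr // mul1r.
Qed.

(** * Roots and Frobenius orbits *)

Lemma splitting_finField (F : finFieldType) (P : {poly F}) : P != 0 ->
  exists (K : finFieldType) (iota : {rmorphism F -> K}) (rs : seq K),
    map_poly iota P %= \prod_(x <- rs) ('X - x%:P).
Proof.
move=> nzP; have [L [rs Prs _]] := FinSplittingFieldFor nzP.
by exists (FinFieldExtType L), (in_alg (FinFieldExtType L)), rs.
Qed.

Lemma dvdp_split_monic (K : fieldType) (p : {poly K}) (rs : seq K) :
    p \is monic -> p %| \prod_(x <- rs) ('X - x%:P) ->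
  exists ts : seq K, p = \prod_(x <- ts) ('X - x%:P).
Proof.
move=> mp /dvdp_prod_XsubC [m]; set ts := mask m rs => pE.
exists ts; apply/eqP; rewrite -eqp_monic ?monic_prod_XsubC //.
Qed.

Lemma dvdp_prod_XsubC_count (K : fieldType) (ts rs : seq K) :
  (\prod_(x <- ts) ('X - x%:P) %| \prod_(x <- rs) ('X - x%:P)) =
  all (fun y => count_mem y ts <= count_mem y rs)%N ts.
Proof.
apply/idP/idP => [dv|/allP le_ts_rs].
  apply/allP => y _; rewrite -!mu_prod_XsubC mup_geq ?monic_neq0 ?monic_prod_XsubC //.
  by apply: dvdp_trans dv; rewrite -mup_geq ?monic_neq0 ?monic_prod_XsubC.
have {}le_ts_rs y : (count_mem y ts <= count_mem y rs)%N.
  have [/le_ts_rs //|/count_memPn -> //] := boolP (y \in ts).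
elim: ts rs le_ts_rs => [|t ts IHts] rs le_ts_rs; first by rewrite big_nil dvd1p.
have trs : t \in rs.
  by rewrite -has_pred1 has_count; apply: leq_trans (le_ts_rs t); rewrite /= eqxx.
rewrite big_cons (perm_big _ (perm_to_rem trs)) big_cons dvdp_mul2l ?polyXsubC_eq0 //.
apply: IHts => y; have := le_ts_rs y.
by rewrite (seq.permP (perm_to_rem trs)) /= leq_add2l.
Qed.

Lemma iter_order_dvd (T : finType) (f : T -> T) : injective f ->
  forall x n, (iter n f x == x) = (order f x %| n)%N.
Proof.
move=> injf x n; set d := order f x.
have d0 : (0 < d)%N by apply: order_gt0.
have itd m : iter (m * d) f x = x.
  by elim: m => // m IHm; rewrite mulSn iterD IHm; apply: iter_order.
rewrite {1}(divn_eq n d) addnC iterD itd /dvdn.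
have ltd : (n %% d < d)%N by rewrite ltn_mod.
apply/eqP/eqP => [E|-> //].
by rewrite -(findex_iter ltd) E findex0.
Qed.

(** The trajectory runs j times around the orbit of x. *)
Lemma count_traject_order (T : finType) (f : T -> T) : injective f ->
  forall x y j, count_mem y (traject f x (j * order f x)) = ((y \in orbit f x) * j)%N.
Proof.
move=> injf x y; elim=> [|j IHj]; first by rewrite muln0.
rewrite mulSn trajectD count_cat iter_order // IHj.
by rewrite [traject _ _ _]/(orbit f x) count_uniq_mem ?orbit_uniq // mulnS.
Qed.

Lemma count_dvdS d v : (0 < d)%N -> (\sum_(n < v * d) (d %| n.+1) = v)%N.
Proof.
move=> d0; rewrite -(big_mkord xpredT (fun n => d %| n.+1 : nat)).
elim: v => [|v IHv]; first by rewrite big_geq.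
rewrite (big_cat_nat (n := v * d)) //= ?leq_mul2r ?leqnSn ?orbT // IHv.
rewrite -[X in \sum_(X <= _ < _) _]add0n big_addn mulSn addnK.
suff -> : (\sum_(0 <= n < d) (d %| (n + v * d).+1) = 1)%N by rewrite addn1.
case: d d0 {IHv} => // d _; rewrite big_nat_recr //= big1_seq ?add0n.
  by rewrite -addSn dvdn_addl ?dvdn_mull ?dvdnn.
move=> n; rewrite mem_index_iota /= => nd.
by rewrite -addSn dvdn_addl ?dvdn_mull // gtnNdvd.
Qed.

Lemma sum_count_uniq (T : eqType) (s rs : seq T) : uniq s ->
  (\sum_(y <- s) count_mem y rs = count [in s] rs)%N.
Proof.
move=> Us; elim: rs => [|r rs IHrs] /=; first by rewrite big1.
rewrite big_split IHrs; congr (_ + _)%N; rewrite -count_uniq_mem //.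
rewrite -sum1_count [RHS]big_mkcond; apply: eq_bigr => y _ /=.
by rewrite eq_sym; case: eqP.
Qed.

(* Each element x contributes its multiplicity v in rs: the admissible n are the multiples j d of
   the length d of its orbit with j <= v. *)
Lemma sum_traject_count (T : finType) (f : T -> T) (rs : seq T) : injective f ->
    (forall x, count_mem (f x) rs = count_mem x rs) ->
  (\sum_(n < size rs) \sum_(x | iter n.+1 f x == x)
     all (fun y => count_mem y (traject f x n.+1) <= count_mem y rs) (traject f x n.+1)
   = size rs)%N.
Proof.
move=> injf frs; rewrite (exchange_big_dep xpredT) //.
transitivity (\sum_x count_mem x rs)%N; last first.
  rewrite -big_enum sum_count_uniq ?enum_uniq // -count_predT.
  by apply: eq_count => x; rewrite mem_enum.
apply: eq_bigr => x _; set v := count_mem x rs; set d := order f x.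
have d0 : (0 < d)%N by apply: order_gt0.
have forb y : y \in orbit f x -> count_mem y rs = v.
  rewrite -fconnect_orbit => /iter_findex <-; elim: (findex _ _ _) => //= n IHn.
  by rewrite frs.
have vd : (v * d <= size rs)%N.
  apply: leq_trans (count_size [in orbit f x] rs).
  rewrite -sum_count_uniq ?orbit_uniq // (eq_big_seq (fun=> v)) //.
  by rewrite big_const_seq count_predT size_orbit iter_addn_0 mulnC.
rewrite -[RHS](count_dvdS v d0) (big_ord_widen _ (fun n => d %| n.+1 : nat) vd).
rewrite [LHS]big_mkcond [RHS]big_mkcond; apply: eq_bigr => n _.
rewrite andTb iter_order_dvd // -/d; case: ifPn => [/dvdnP[j nE]|_]; last by case: ifP.
set b := all _ _; suff -> : b = (n < v * d)%N by case: ifP.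
rewrite /b nE leq_pmul2r //; apply/allP/idP => [H|jv y _].
  have := H x; rewrite /d count_traject_order // -fconnect_orbit connect0 mul1n; apply.
  rewrite -(@prednK j) ?mulSn ?trajectD ?mem_cat; last by case: (j) nE.
  by rewrite [traject _ _ _]/(orbit f x) -fconnect_orbit connect0.
by rewrite /d count_traject_order //; case: (boolP (y \in _)) => // /forb ->; rewrite mul1n.
Qed.

(** * Sums over monic polynomials *)

(** The lower coefficients index the monic polynomials of degree k by a finite type. *)
Definition monic_of_row (F : fieldType) k (v : 'rV[F]_k) : {poly F} := 'X^k + rVpoly v.

Lemma size_monic_of_row (F : fieldType) k (v : 'rV[F]_k) : size (monic_of_row v) = k.+1.
Proof. by rewrite size_polyDl size_polyXn // ltnS size_poly. Qed.

Lemma monic_of_row_monic (F : fieldType) k (v : 'rV[F]_k) : monic_of_row v \is monic.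
Proof.
by rewrite monicE lead_coefDl ?lead_coefXn // size_polyXn ltnS size_poly.
Qed.

Lemma monic_of_rowK (F : fieldType) k :
  cancel (@monic_of_row F k) (fun h => poly_rV (h - 'X^k)).
Proof. by move=> v; rewrite /monic_of_row addrC addKr rVpolyK. Qed.

Lemma poly_rV_monicK (F : fieldType) k (h : {poly F}) :
  h \is monic -> size h = k.+1 -> monic_of_row (poly_rV (h - 'X^k) : 'rV_k) = h.
Proof.
move=> mh szh; rewrite /monic_of_row poly_rV_K ?[_ + (_ - _)]addrC ?subrK //.
apply/leq_sizeP => j; rewrite leq_eqVlt coefB coefXn => /predU1P[<-|kj].
  by move: mh; rewrite monicE lead_coefE szh /= eqxx => /eqP ->; rewrite subrr.
by rewrite nth_default ?szh // gtn_eqF // subr0.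
Qed.

(** The coefficient of T^k in the L-function of [Lam]. *)
Definition monic_sum (F : finFieldType) (Lam : {poly F} -> algC) k :=
  \sum_(v : 'rV[F]_k) Lam (monic_of_row v).

(** Division by g is a bijection from the monic multiples of g of degree k onto the monic
    polynomials of degree k - n. *)
Lemma monic_sum_dvd (F : finFieldType) (Lam : {poly F} -> algC) (g : {poly F}) n k :
    {morph Lam : a b / a * b} -> g \is monic -> size g = n.+1 -> (n <= k)%N ->
  \sum_(v : 'rV[F]_k | g %| monic_of_row v) Lam (monic_of_row v) =
    Lam g * monic_sum Lam (k - n).
Proof.
move=> LamM mg szg nk; rewrite mulr_sumr.
have ng : g != 0 by apply: monic_neq0.
pose to (w : 'rV[F]_(k - n)) : 'rV[F]_k := poly_rV (g * monic_of_row w - 'X^k).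
pose fro (v : 'rV[F]_k) : 'rV[F]_(k - n) := poly_rV (monic_of_row v %/ g - 'X^(k - n)).
have toE w : monic_of_row (to w) = g * monic_of_row w.
  rewrite poly_rV_monicK ?monicMl ?monic_of_row_monic //.
  rewrite size_monicM ?monic_neq0 ?monic_of_row_monic // szg size_monic_of_row.
  by rewrite addSn addnS /= subnKC.
have froE v : g %| monic_of_row v -> g * monic_of_row (fro v) = monic_of_row v.
  move=> dv; have E : monic_of_row v %/ g * g = monic_of_row v by rewrite divpK.
  rewrite mulrC poly_rV_monicK //.
    by rewrite -(monicMr _ mg) E monic_of_row_monic.
  by rewrite size_divp // szg size_monic_of_row subSn.
rewrite (reindex_onto to fro) /=; last first.
  move=> v dv; apply: (can_inj (@monic_of_rowK F k)).
  by rewrite toE froE.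
apply: eq_big => [w|w _]; last by rewrite toE LamM.
rewrite toE dvdp_mulIl /=; apply/eqP; apply: (can_inj (@monic_of_rowK F (k - n))).
by apply: (mulfI ng); rewrite froE ?toE ?dvdp_mulIl.
Qed.

(* Values at one point can be multiplied by u while the other values stay fixed, by adding a
   multiple of a Lagrange polynomial of degree m < k. *)
Lemma monic_sum0 (F : finFieldType) m (a : 'I_m.+1 -> F) (psi : 'I_m.+1 -> F -> algC) i0 u k :
    injective a -> (forall i, {morph psi i : x y / x * y}) -> u != 0 -> psi i0 u != 1 ->
    (m < k)%N ->
  monic_sum (fun h => \prod_i psi i h.[a i]) k = 0.
Proof.
move=> inja psiM nu psiu mk.
pose l : {poly F} := (\prod_(i | i != i0) (a i0 - a i))^-1 *: \prod_(i | i != i0) ('X - (a i)%:P).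
have l1 : l.[a i0] = 1.
  rewrite hornerZ horner_prod; under [X in _ * X]eq_bigr do rewrite !hornerE.
  by rewrite mulVf //; apply/prodf_neq0 => i ni; rewrite subr_eq0 (inj_eq inja) eq_sym.
have l0 i : i != i0 -> l.[a i] = 0.
  by move=> ni; rewrite hornerZ horner_prod [X in _ * X](bigD1 i) //= hornerXsubC subrr mul0r mulr0.
have szl : (size l <= k)%N.
  apply: leq_trans (size_scale_leq _ _) _; rewrite -big_filter size_prod_XsubC.
  apply: leq_trans mk; rewrite ltnS size_filter -sum1_count sum1_card.
  by rewrite cardC1 card_ord.
pose f c (v : 'rV[F]_k) : 'rV[F]_k := v + poly_rV (c * (monic_of_row v).[a i0] *: l).
have fE c v : monic_of_row (f c v) = monic_of_row v + c * (monic_of_row v).[a i0] *: l.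
  rewrite /monic_of_row /f linearD /= addrA poly_rV_K //.
  exact: leq_trans (size_scale_leq _ _) szl.
(* [f c] multiplies the value at [a i0] by 1 + c, so parameters compose as (1 + c)(1 + d) - 1, and u
   - 1 is inverse to u^-1 - 1. *)
have ff c d v : f d (f c v) = v + poly_rV ((c + d + d * c) * (monic_of_row v).[a i0] *: l).
  rewrite {1}/f fE hornerD hornerZ l1 mulr1 {1}/f -addrA -linearD /= -scalerDl.
  by congr (_ + poly_rV (_ *: _)); ring.
have fK : cancel (f (u - 1)) (f (u^-1 - 1)).
  move=> v; rewrite ff [_ + _ + _](_ : _ = 0) ?mul0r ?scale0r ?linear0 ?addr0 //.
  by field.
set S := monic_sum _ _; suff : S = psi i0 u * S.
  move/eqP; rewrite -subr_eq0 -{1}[S]mul1r -mulrBl mulf_eq0 subr_eq0 eq_sym.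
  by rewrite (negPf psiu) => /eqP.
rewrite {1}/S /monic_sum (reindex_inj (can_inj fK)) mulr_sumr; apply: eq_bigr => v _.
rewrite (bigD1 i0) //= [in RHS](bigD1 i0) //= mulrA; congr (_ * _).
  by rewrite fE hornerD hornerZ l1 mulr1 -psiM; congr psi; ring.
by apply: eq_bigr => i ni; rewrite fE hornerD hornerZ l0 // mulr0 addr0.
Qed.

(** * Character sums over extensions of the prime field *)

(** A single finite field replaces the algebraic closure up to degree N: F_{p^n} is the set of x in
    [K] with x^(p^n) = x. *)
Lemma exists_split_field p N : prime p ->
  exists (K : finFieldType) (iota : {rmorphism 'F_p -> K}),
   (forall h : {poly 'F_p}, h \is monic -> (size h <= N.+1)%N ->
      exists rs, map_poly iota h = \prod_(x <- rs) ('X - x%:P)) /\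
   (forall n, (0 < n <= N)%N -> #|[set x : K | x ^+ (p ^ n) == x]| = (p ^ n)%N).
Proof.
move=> pr_p.
(* [K] splits P1 * P2: P1 is a multiple of every nonzero polynomial of degree at most N, and P2
   brings in the fields F_{p^n}. *)
pose P1 : {poly 'F_p} := \prod_(w : 'rV['F_p]_N.+1 | rVpoly w != 0) rVpoly w.
pose P2 : {poly 'F_p} := \prod_(n < N) ('X^(p ^ n.+1) - 'X).
have p1 n : (1 < p ^ n.+1)%N by rewrite -{1}(exp1n n.+1) ltn_exp2r ?prime_gt1.
have szP n (R : nzRingType) : size ('X^(p ^ n.+1) - 'X : {poly R}) = (p ^ n.+1).+1.
  by rewrite size_polyDl size_polyXn // size_polyN size_polyX ltnS.
have mP n (R : nzRingType) : ('X^(p ^ n.+1) - 'X : {poly R}) \is monic.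
  by rewrite monicE lead_coefDl ?lead_coefXn // size_polyXn size_polyN size_polyX ltnS.
have nzP : P1 * P2 != 0.
  rewrite mulf_neq0 //; apply/prodf_neq0 => // n _; exact: monic_neq0 (mP _ _).
have [K [iota [rs Prs]]] := splitting_finField nzP; exists K, iota.
have split h : h \is monic -> h %| P1 * P2 ->
    exists rs, map_poly iota h = \prod_(x <- rs) ('X - x%:P).
  move=> mh hP; apply: (@dvdp_split_monic _ _ rs); first by rewrite map_monic.
  by rewrite -(eqp_dvdr _ Prs) dvdp_map.
split=> [h mh szh|[//|n] /andP[_ nN]].
  apply: split => //; apply: dvdp_mulr.
  rewrite /P1 (bigD1 (poly_rV h)) ?poly_rV_K ?monic_neq0 //=.
  exact: dvdp_mulIl.
have [|ts tsE] := split _ (mP n _).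
  by apply: dvdp_mull; rewrite /P2 (bigD1 (Ordinal nN)) //= dvdp_mulIl.
have {}tsE : 'X^(p ^ n.+1) - 'X = \prod_(x <- ts) ('X - x%:P) :> {poly K}.
  by rewrite -tsE rmorphB /= map_polyXn map_polyX.
have pchK : p \in [pchar K] by rewrite (fmorph_pchar iota) pchar_Fp.
(* X^(p^n) - X has derivative -1, hence p^n distinct roots. *)
have Uts : uniq ts.
  rewrite -separable_prod_XsubC -tsE unlock derivB derivXn derivX.
  rewrite (_ : _ *+ _ = 0); last first.
    rewrite -mulr_natr (_ : (p ^ n.+1)%:R = 0) ?mulr0 //.
    by rewrite natrX (pcharf0 _) ?expr0n // pchar_poly.
  by rewrite sub0r -[X in coprimep _ X]scaleN1r coprimepZr ?oppr_eq0 ?oner_eq0 // coprimep1.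
rewrite (_ : [set x | _] = [set x in ts]).
  have /eqP := congr1 (fun q : {poly K} => size q) tsE.
  rewrite szP size_prod_XsubC eqSS => /eqP ->.
  by rewrite cardsE; apply/card_uniqP.
apply/setP => x; rewrite !inE -root_prod_XsubC -tsE rootE hornerD hornerN hornerXn hornerX.
by rewrite subr_eq0.
Qed.


Lemma mup_map (K L : fieldType) (f : {rmorphism K -> L}) x q : q != 0 ->
  mup (f x) (map_poly f q) = mup x q.
Proof.
move=> nq.
have mf n : ((n <= mup (f x) (map_poly f q)) = (n <= mup x q))%N.
  rewrite !mup_geq ?map_poly_eq0 // -(dvdp_map f) rmorphXn rmorphB /=.
  by rewrite map_polyX map_polyC.
by apply/eqP; rewrite eqn_leq -mf leqnn mf leqnn.
Qed.

(** * Frobenius orbits and characteristic polynomials *)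

Section FrobeniusOrbits.

Variables (p : nat) (K : finFieldType) (iota : {rmorphism 'F_p -> K}).
Hypothesis pr_p : prime p.

Lemma pchar_ext : p \in [pchar K].
Proof. by rewrite (fmorph_pchar iota) pchar_Fp. Qed.

Local Notation frob := (pFrobenius_aut pchar_ext).

Lemma iter_frob n x : iter n frob x = x ^+ (p ^ n).
Proof.
elim: n => [|n IHn]; first by rewrite expr1.
by rewrite iterS IHn pFrobenius_autE -exprM -expnSr.
Qed.

Lemma iter_frobB n x y : iter n frob (x - y) = iter n frob x - iter n frob y.
Proof. by elim: n => //= n ->; rewrite rmorphB. Qed.

Lemma iter_frob_iota n a : iter n frob (iota a) = iota a.
Proof.
elim: n => //= n ->; rewrite pFrobenius_autE -rmorphXn.
by have := expf_card a; rewrite card_Fp // => ->.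
Qed.

(** X^p - X already splits over 'F_p, so all its roots in [K] come from there. *)
Lemma frob_fix y : y ^+ p = y -> exists a, y = iota a.
Proof.
move=> yp; have : root (map_poly iota ('X^#|'F_p| - 'X)) y.
  rewrite rmorphB /= map_polyXn map_polyX rootE hornerD hornerN hornerXn hornerX.
  by rewrite card_Fp // yp subrr.
rewrite finField_genPoly rmorph_prod /= -big_enum.
under eq_bigr do rewrite rmorphB /= map_polyX map_polyC.
rewrite -(big_map iota xpredT (fun z => 'X - z%:P)) root_prod_XsubC => /mapP[a _ ->].
by exists a.
Qed.

(** The inverse of [iota] on its image; 0 is a default elsewhere. *)
Definition descend (y : K) : 'F_p := odflt 0 [pick a | iota a == y].

Lemma descendK y : y ^+ p = y -> iota (descend y) = y.
Proof.
move=> /frob_fix[a ->]; rewrite /descend; case: pickP => [b /eqP //|/(_ a)].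
by rewrite eqxx.
Qed.

Lemma iotaK : cancel iota descend.
Proof.
move=> a; apply: (fmorph_inj iota); apply: descendK.
by rewrite -rmorphXn; have := expf_card a; rewrite card_Fp // => ->.
Qed.

(** When x lies in F_{p^n}, this is its characteristic polynomial over F_p, a power of the minimal
    polynomial. *)
Definition orbit_poly n (x : K) : {poly 'F_p} :=
  map_poly descend (\prod_(y <- traject frob x n) ('X - y%:P)).

(** Frobenius rotates the trajectory of x cyclically, so it fixes the coefficients of the product,
    which therefore descend to 'F_p. *)
Lemma orbit_polyE n x : x ^+ (p ^ n) = x ->
  map_poly iota (orbit_poly n x) = \prod_(y <- traject frob x n) ('X - y%:P).
Proof.
move=> xn; apply/polyP => i; rewrite !coef_map_id0 ?rmorph0 //; last first.
  by rewrite -(rmorph0 iota) iotaK.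
apply: descendK; rewrite -(pFrobenius_autE pchar_ext) -coef_map; congr (_`_i).
rewrite rmorph_prod /=.
under eq_bigr do rewrite rmorphB /= map_polyX map_polyC.
rewrite -(big_map frob xpredT (fun z => 'X - z%:P)).
case: n xn => // n xn.
have -> : map frob (traject frob x n.+1) = rcons (traject frob (frob x) n) x.
  have mt m z : map frob (traject frob z m) = traject frob (frob z) m.
    by elim: m z => //= m IHm z; rewrite IHm.
  by rewrite mt trajectSr -iterSr iter_frob xn.
by rewrite -cats1 big_cat big_seq1 trajectS big_cons mulrC.
Qed.

Lemma orbit_poly_monic n x : x ^+ (p ^ n) = x -> orbit_poly n x \is monic.
Proof. by move=> xn; rewrite -(map_monic iota) orbit_polyE // monic_prod_XsubC. Qed.

Lemma size_orbit_poly n x : x ^+ (p ^ n) = x -> size (orbit_poly n x) = n.+1.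
Proof.
by move=> xn; rewrite -(size_map_poly iota) orbit_polyE // size_prod_XsubC size_traject.
Qed.

Lemma frob_inj : injective frob.
Proof. exact: fmorph_inj. Qed.

(** The value at a is the norm of [iota a - x] from F_{p^n} to F_p, that is, the power of exponent 1
    + p + ... + p^(n-1). *)
Lemma horner_orbit_poly n x (a : 'F_p) : x ^+ (p ^ n) = x ->
  (orbit_poly n x).[a] = descend ((iota a - x) ^+ (\sum_(i < n) p ^ i)).
Proof.
move=> xn; apply: (fmorph_inj iota); rewrite -horner_map orbit_polyE //.
have E : (\prod_(y <- traject frob x n) ('X - y%:P)).[iota a] =
    (iota a - x) ^+ (\sum_(i < n) p ^ i).
  rewrite horner_prod; under eq_bigr do rewrite hornerXsubC.
  elim: (n) => [|m IHm]; first by rewrite big_nil big_ord0 expr0.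
  rewrite trajectSr -cats1 big_cat big_seq1 /= IHm big_ord_recr /= exprD.
  by congr (_ * _); rewrite -!iter_frob iter_frobB iter_frob_iota.
rewrite E descendK // -E -orbit_polyE // horner_map -rmorphXn /=.
by have := expf_card (orbit_poly n x).[a]; rewrite card_Fp // => ->.
Qed.

(** The character sum S_n over F_{p^n}: by [horner_orbit_poly], evaluating at orbit polynomials
    composes characters of F_p with the norm. *)
Definition orbit_sum (Lam : {poly 'F_p} -> algC) n : algC :=
  \sum_(x | x ^+ (p ^ n) == x) Lam (orbit_poly n x).


(** The logarithmic derivative of the L-function, without Euler product. By [sum_traject_count], a
    monic h of degree k+1 is divisible by [orbit_poly i.+1 x] for exactly k+1 pairs (i, x);
    exchanging the sums and applying [monic_sum_dvd] gives the right-hand side. *)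
Lemma newton_orbit_sum (Lam : {poly 'F_p} -> algC) N k :
    {morph Lam : a b / a * b} ->
    (forall h : {poly 'F_p}, h \is monic -> (size h <= N.+1)%N ->
      exists rs, map_poly iota h = \prod_(x <- rs) ('X - x%:P)) ->
    (k < N)%N ->
  monic_sum Lam k.+1 *+ k.+1 =
    \sum_(i < k.+1) orbit_sum Lam i.+1 * monic_sum Lam (k - i).
Proof.
move=> LamM split kN; rewrite -mulr_natr mulr_suml.
transitivity (\sum_(i < k.+1) \sum_(x | x ^+ (p ^ i.+1) == x)
   \sum_(v : 'rV['F_p]_k.+1 | orbit_poly i.+1 x %| monic_of_row v)
     Lam (monic_of_row v)); last first.
  apply: eq_bigr => i _; rewrite mulr_suml; apply: eq_bigr => x /eqP xi.
  rewrite (@monic_sum_dvd _ _ _ i.+1) ?orbit_poly_monic ?size_orbit_poly //.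
under [RHS]eq_bigr do rewrite (exchange_big_dep xpredT) //=.
rewrite exchange_big /=; apply: eq_bigr => v _.
have [rs rsE] : exists rs, map_poly iota (monic_of_row v) = \prod_(x <- rs) ('X - x%:P).
  by apply: split; rewrite ?monic_of_row_monic ?size_monic_of_row.
have szrs : size rs = k.+1.
  apply: succn_inj; rewrite -(size_prod_XsubC _ id) -rsE size_map_poly.
  exact: size_monic_of_row.
have frs x : count_mem (frob x) rs = count_mem x rs.
  rewrite -!mu_prod_XsubC -rsE -[RHS](mup_map frob); last first.
    by rewrite map_poly_eq0 monic_neq0 ?monic_of_row_monic.
  rewrite -map_poly_comp.
  congr (mup _ _); apply: eq_map_poly => a /=.
  by symmetry; exact: (iter_frob_iota 1 a).
have := sum_traject_count frob_inj frs; rewrite szrs => E.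
rewrite -[X in _ * X%:R]E natr_sum mulr_sumr {E}.
apply: eq_bigr => i _; rewrite natr_sum mulr_sumr big_mkcond [RHS]big_mkcond.
apply: eq_bigr => x _; rewrite iter_frob; case: eqP => // xi.
rewrite -dvdp_prod_XsubC_count -orbit_polyE // -rsE dvdp_map.
by case: (_ %| _); rewrite /= ?mulr1 ?mulr0.
Qed.

End FrobeniusOrbits.

(** * The Stepanov-Bombieri bound *)

Lemma expr_sum_pchar (R : comNzRingType) p mu (I : Type) (r : seq I) (P : pred I) (f : I -> R) :
  p \in [pchar R] ->
  (\sum_(i <- r | P i) f i) ^+ (p ^ mu) = \sum_(i <- r | P i) f i ^+ (p ^ mu).
Proof.
move=> pchR; elim: mu => [|mu IHmu]; first by under [RHS]eq_bigr do rewrite expn0 expr1.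
under [RHS]eq_bigr do rewrite expnSr exprM.
by rewrite expnSr exprM IHmu -(pFrobenius_autE pchR) rmorph_sum.
Qed.

(** If s were nonzero, cancelling gcd(r, s) would make F a constant times a square r1^2; then r1
    divides F and F', so F is constant. *)
Lemma separable_not_square (K : fieldType) (F r s : {poly K}) (c : K) :
    coprimep F F^`() -> (1 < size F)%N -> c != 0 ->
  r ^+ 2 = c *: (s ^+ 2 * F) -> s = 0.
Proof.
move=> sepF sF c0 rE; apply/eqP/negPn/negP => s0.
have F0 : F != 0 by rewrite -size_poly_gt0 ltnW.
pose g := gcdp r s; have g0 : g != 0 by rewrite gcdp_eq0 negb_and s0 orbT.
pose r1 := r %/ g; pose s1 := s %/ g.
have rg : r = r1 * g by rewrite divpK ?dvdp_gcdl.
have sg : s = s1 * g by rewrite divpK ?dvdp_gcdr.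
have cop : coprimep r1 s1 by rewrite coprimep_div_gcd // s0 orbT.
have E : r1 ^+ 2 = c *: (s1 ^+ 2 * F).
  apply: (mulIf (expf_neq0 2 g0)); rewrite -exprMn -rg rE sg exprMn.
  by rewrite -scalerAl mulrAC.
have us1 : size s1 = 1%N.
  apply/eqP; rewrite -dvdp1 -(Gauss_dvdpr 1 (_ : coprimep s1 (r1 ^+ 2))); last first.
    by rewrite coprimep_sym coprimep_expl.
  by rewrite mulr1 E dvdpZr // expr2 -mulrA dvdp_mulIl.
have [d d0 sd] : exists2 d, d != 0 & s1 = d%:P.
  by exists s1`_0; [rewrite -polyC_eq0|]; rewrite -size1_polyC ?us1 // -size_poly_gt0 us1.
have FE : F = (c * d ^+ 2)^-1 *: r1 ^+ 2.
  rewrite E sd -rmorphXn /= mul_polyC !scalerA -mulrA.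
  by rewrite mulVf ?scale1r ?mulf_neq0 ?expf_neq0.
have r1F : r1 %| F by rewrite FE dvdpZr ?invr_eq0 ?mulf_neq0 ?expf_neq0 // expr2 dvdp_mulIl.
have r1F' : r1 %| F^`().
  rewrite FE derivZ dvdpZr ?invr_eq0 ?mulf_neq0 ?expf_neq0 // deriv_exp.
  by rewrite -mulr_natr expr1 -mulrA mulrCA dvdp_mulIl.
have /size_poly1P[e _ r1e] : size r1 == 1%N.
  by rewrite size_poly_eq1; move/coprimepP: sepF; apply.
move: sF; rewrite FE r1e -rmorphXn ltnNge => /negP; apply.
by apply: leq_trans (size_scale_leq _ _) (size_polyC_leq1 _).
Qed.

Lemma size_mul_bound (R : nzRingType) (p q : {poly R}) a b :
  (size p <= a.+1)%N -> (size q <= b.+1)%N -> (size (p * q)%R <= (a + b).+1)%N.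
Proof.
move=> pa qb; apply: leq_trans (size_polyMleq _ _) _.
by move: (size p) (size q) pa qb => x y; lia.
Qed.

Lemma size_exp_bound (R : nzRingType) (p : {poly R}) a n :
  (size p <= a.+1)%N -> (size (p ^+ n)%R <= (a * n).+1)%N.
Proof.
move=> pa; apply: leq_trans (size_poly_exp_leq _ _) _; rewrite ltnS leq_mul2r.
by apply/orP; right; move: (size p) pa => x; lia.
Qed.

Section Stepanov.

Variables (K : finFieldType) (p mu t D : nat) (F : {poly K}) (e : K).
Hypotheses (pchK : p \in [pchar K]) (Qt : (p ^ mu = t.*2.+1)%N) (Dt : (0 < D <= t)%N).
Hypotheses (sepF : coprimep F F^`()) (szF : size F = D.+1) (F0 : F.[0] != 0).

Local Notation Q := (p ^ mu)%N.
Local Notation G := (F ^+ t.+1).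

(** Modulo X^Q the relation reads r_0 = - s_0 G. Squaring, with G^2 = F^(Q+1) congruent to F(0)^Q F,
    shows that X^Q divides r_0^2 - F(0)^Q s_0^2 F. The degree is below Q, so this vanishes and
    [separable_not_square] gives s_0 = r_0 = 0; divide by X^Q and repeat. *)
Lemma stepanov_indep J (r s : nat -> {poly K}) :
    (forall j, (size (r j) <= t.+1)%N) -> (forall j, (size (s j) <= t.+1 - D)%N) ->
    \sum_(j < J) 'X^(j * Q) * (r j + s j * G) = 0 ->
  forall j, (j < J)%N -> r j = 0 /\ s j = 0.
Proof.
elim: J r s => // J IHJ r s szr szs sum0.
pose R' := \sum_(j < J) 'X^(j * Q) * r j.+1; pose S' := \sum_(j < J) 'X^(j * Q) * s j.+1.
have pchKX : p \in [pchar {poly K}] by rewrite pchar_poly.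
have sumE (f : nat -> {poly K}) :
    \sum_(j < J.+1) 'X^(j * Q) * f j = f 0%N + 'X^Q * \sum_(j < J) 'X^(j * Q) * f j.+1.
  rewrite big_ord_recl mul0n expr0 mul1r; congr (_ + _); rewrite mulr_sumr.
  by apply: eq_bigr => j _; rewrite mulrA -exprD -mulSn.
have RS : r 0%N + 'X^Q * R' = - (s 0%N + 'X^Q * S') * G.
  apply/eqP; rewrite mulNr -addr_eq0 -!sumE mulr_suml -big_split -[X in _ == X]sum0.
  by apply/eqP; apply: eq_bigr => j _; rewrite mulrDr mulrA.
have Q0 : (0 < Q)%N by rewrite Qt.
have [F1 F1E] : exists F1, F = F.[0]%:P + 'X * F1.
  have /factor_theorem[F1 F1E] : root (F - F.[0]%:P) 0.
    by rewrite rootE hornerD hornerN hornerC subrr.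
  by exists F1; rewrite mulrC -[X in F1 * X]subr0 -F1E addrC subrK.
have FQ : F ^+ Q = (F.[0] ^+ Q)%:P + 'X^Q * F1 ^+ Q.
  have := expr_sum_pchar mu [:: F.[0]%:P; 'X * F1] xpredT id pchKX.
  by rewrite !big_cons !big_nil !addr0 -F1E exprMn rmorphXn.
have /eqP : (r 0%N) ^+ 2 - (F.[0] ^+ Q) *: ((s 0%N) ^+ 2 * F) = 0.
  apply/eqP; rewrite -size_poly_eq0 -leqn0 leqNgt; apply/negP => sz0.
  have : 'X^Q %| (r 0%N) ^+ 2 - (F.[0] ^+ Q) *: ((s 0%N) ^+ 2 * F).
    have := congr1 (fun u => u ^+ 2) RS; rewrite /= exprMn -exprM muln2 sqrrN.
    rewrite (_ : t.+1.*2 = Q.+1)%N; last by rewrite Qt. rewrite [F ^+ _]exprS FQ => /eqP.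
    rewrite -subr_eq0 -mul_polyC => /eqP.
    move: (r 0%N) (s 0%N) ('X^Q) (F1 ^+ Q) (_%:P) => r0 s0 x f c E.
    apply/dvdpP; exists (f * F * (s0 + x * S') ^+ 2 + c * F * (s0 * S' *+ 2 + x * S' ^+ 2)
      - (r0 * R' *+ 2 + x * R' ^+ 2)).
    by apply/eqP; rewrite -subr_eq0 -E; apply/eqP; ring.
  move/(dvdp_leq _); rewrite -size_poly_gt0 size_polyXn => /(_ sz0).
  rewrite leqNgt ltnS (leq_trans (size_polyD _ _)) // size_polyN geq_max.
  rewrite (leq_trans (size_scale_leq _ _)) ?andbT.
    rewrite expr2 (leq_trans (size_polyMleq _ _)) // Qt.
    by move: (size (r 0%N)) (szr 0%N) => z; lia.
  rewrite expr2 (leq_trans (size_polyMleq _ _)) // szF.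
  move: (size_polyMleq (s 0%N) (s 0%N)) (szs 0%N) Dt; rewrite Qt.
  by move: (size (s 0%N * s 0%N)) (size (s 0%N)) => y z; lia.
rewrite subr_eq0 => /eqP r0E.
have s00 : s 0%N = 0.
  apply: (separable_not_square sepF _ _ r0E); rewrite ?szF ?expf_neq0 //.
  by case/andP: Dt.
have r00 : r 0%N = 0.
  by move/eqP: r0E; rewrite s00 expr0n mul0r scaler0 expf_eq0 => /eqP.
case=> [|j] // jJ; apply: (IHJ (fun j => r j.+1) (fun j => s j.+1)) => //.
apply/eqP; have /eqP := sum0; rewrite (sumE (fun j => r j + s j * G)) r00 s00 mul0r !add0r.
by rewrite mulf_eq0 expf_eq0 polyX_eq0 andbF.
Qed.


(** The sum is additive in (r, s) though not linear over [K], so a pigeonhole count replaces linear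
    algebra. Taking t + 1 + D terms makes the number of coefficients of (r, s) exceed the number of
    coefficients of the sum. *)
Lemma stepanov_auxiliary :
  exists r s : nat -> {poly K},
   [/\ forall j, (size (r j) <= t.+1)%N, forall j, (size (s j) <= t.+1 - D)%N,
       exists2 j, (j < t.+1 + D)%N & (r j != 0) || (s j != 0)
     & \sum_(j < t.+1 + D) 'X^j * (r j ^+ Q + e *: (s j ^+ Q * G)) = 0].
Proof.
set J := (t.+1 + D)%N; pose T := (J + Q * t)%N.
have subD : (t.+1 - D = (t - D).+1)%N by case/andP: Dt => _ /subSn.
have pchKX : p \in [pchar {poly K}] by rewrite pchar_poly.
pose dom : finType := ('M[K]_(J, t.+1) * 'M[K]_(J, t.+1 - D))%type.
pose f (A : dom) : {poly K} := \sum_(j < J) 'X^j *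
  (rVpoly (row j A.1) ^+ Q + e *: (rVpoly (row j A.2) ^+ Q * G)).
have szf A : (size (f A) <= T)%N.
  apply: (leq_trans (size_sum _ _ _)); apply/bigmax_leqP => j _.
  have szr : (size (rVpoly (row j A.1)) <= t.+1)%N by apply: size_poly.
  have szs : (size (rVpoly (row j A.2)) <= (t - D).+1)%N.
    by rewrite -subD; apply: size_poly.
  apply: (@leq_trans (j + t * Q).+1); last first.
    by rewrite /T -addSn [(Q * t)%N]mulnC leq_add2r.
  apply: size_mul_bound; first by rewrite size_polyXn.
  rewrite (leq_trans (size_polyD _ _)) // geq_max size_exp_bound //=.
  rewrite (leq_trans (size_scale_leq _ _)) //.
  have szG : (size G <= (D * t.+1).+1)%N by apply: size_exp_bound; rewrite szF.
  apply: leq_trans (size_mul_bound (size_exp_bound Q szs) szG) _.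
  by rewrite Qt; move: Dt; nia.
have fB A B : f (A.1 - B.1, A.2 - B.2) = f A - f B.
  rewrite /f -sumrB; apply: eq_bigr => j _ /=.
  rewrite !linearB /= -mulrBr; congr (_ * _).
  have powB (x y : {poly K}) : (x - y) ^+ Q = x ^+ Q - y ^+ Q.
    have := expr_sum_pchar mu [:: x - y; y] xpredT id pchKX.
    by rewrite !big_cons !big_nil !addr0 subrK => ->; rewrite addrK.
  by rewrite !powB mulrBl scalerBr; ring.
(* Two distinct families have the same image; their difference is the required pair. *)
have /injectivePn[A [B neAB fAB]] : ~~ injectiveb (fun A => poly_rV (f A) : 'rV[K]_T).
  apply/negP => /injectiveP /leq_card; apply/negP; rewrite -ltnNge.
  rewrite card_prod !card_mx -expnD mul1n ltn_exp2l ?finNzRing_gt1 //.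
  by rewrite /T /J subD Qt; move: Dt; nia.
have f0 : f (A.1 - B.1, A.2 - B.2) = 0.
  by rewrite fB -(poly_rV_K (szf A)) -(poly_rV_K (szf B)) fAB subrr.
pose r j := if insub j is Some j' then rVpoly (row j' (A.1 - B.1)) else 0.
pose s j := if insub j is Some j' then rVpoly (row j' (A.2 - B.2)) else 0.
exists r, s; split.
- by move=> j; rewrite /r; case: insubP => [j' _ _|_]; rewrite ?size_poly ?size_poly0.
- by move=> j; rewrite /s; case: insubP => [j' _ _|_]; rewrite ?size_poly ?size_poly0.
- have : (A.1 - B.1 != 0) || (A.2 - B.2 != 0).
    rewrite -negb_and; apply: contra neAB; rewrite !subr_eq0 => /andP[/eqP e1 /eqP e2].
    by rewrite [A]surjective_pairing e1 e2 -surjective_pairing.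
  have nz n (M : 'M[K]_(J, n)) : M != 0 -> exists j, rVpoly (row j M) != 0.
    move=> nzM; apply/existsP; apply: contraNT nzM; rewrite negb_exists => /forallP rM0.
    apply/eqP/row_matrixP => j; rewrite row0; apply: (can_inj rVpolyK).
    by rewrite linear0; apply/eqP; rewrite -[_ == _]negbK rM0.
  case/orP => /nz [j nzj]; exists j; rewrite ?ltn_ord // /r /s valK nzj ?orbT //.
rewrite -[RHS]f0; apply: eq_bigr => j _.
by rewrite /r /s valK.
Qed.


(** The polynomial g = sum_j X^(jQ) (r_j + s_j G) is nonzero by independence and vanishes at every
    counted x: its Q-th power there equals the vanishing sum of [stepanov_auxiliary] at x. The
    degree of g then bounds the count. *)
Lemma stepanov_bound :
  (2 * #|[set x : K | (x ^+ (Q * Q) == x) && (F.[x] ^+ (t * t.+1).*2 == e)]|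
    <= Q * Q + 3 * D * Q)%N.
Proof.
have [r [s [szr szs [j jJ nzj] sum0]]] := stepanov_auxiliary.
set Z := [set x | _]; set J := (t.+1 + D)%N in jJ sum0.
pose g := \sum_(j < J) 'X^(j * Q) * (r j + s j * G).
have g0 : g != 0.
  apply/negP => /eqP /(stepanov_indep szr szs) /(_ _ jJ) [r0 s0].
  by rewrite r0 s0 eqxx in nzj.
have gZ x : x \in Z -> root g x.
  rewrite inE => /andP[/eqP xq /eqP Fx];

  have : g.[x] ^+ Q = 0.
    rewrite /g horner_sum expr_sum_pchar //.
    have := congr1 (horner^~ x) sum0; rewrite /= horner_sum horner0 => {2}<-.
    apply: eq_bigr => i _.
    rewrite !hornerM !hornerXn hornerD !hornerM hornerD horner_exp hornerZ !hornerM !horner_exp.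
    rewrite exprMn -exprM -mulnA [(i * _)%N]mulnC exprM xq; congr (_ * _).
    have := expr_sum_pchar mu [:: (r i).[x]; (s i).[x] * F.[x] ^+ t.+1] xpredT id pchK.
    rewrite !big_cons !big_nil !addr0 => ->; congr (_ + _).
    rewrite exprMn mulrCA; congr (_ * _).
    (* Here (t+1) Q = 2t(t+1) + (t+1), so G(x)^Q = e G(x). *)
    rewrite -exprM -Fx -exprD; congr (_ ^+ _); rewrite Qt; nia.
  by move/eqP; rewrite expf_eq0 rootE => /andP[].
have cardZ : (#|Z| < size g)%N.
  rewrite cardE; apply: max_poly_roots => //; last exact: enum_uniq.
  by apply/allP => x; rewrite mem_enum; apply: gZ.
have subD : (t.+1 - D = (t - D).+1)%N by case/andP: Dt => _ /subSn.
have szg : (size g <= ((t + D) * Q + (t + D * t)).+1)%N.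
  apply: (leq_trans (size_sum _ _ _)); apply/bigmax_leqP => i _.
  have szG : (size G <= (D * t.+1).+1)%N by apply: size_exp_bound; rewrite szF.
  apply: leq_trans (_ : _ <= (i * Q + (t + D * t)).+1)%N _; last first.
    by rewrite ltnS leq_add2r leq_mul2r -ltnS -addSn (ltn_ord i) orbT.
  apply: size_mul_bound; first by rewrite size_polyXn.
  rewrite (leq_trans (size_polyD _ _)) // geq_max (leq_trans (szr _)) ?ltnS ?leq_addr //=.
  have szsi : (size (s i) <= (t - D).+1)%N by rewrite -subD.
  apply: leq_trans (size_mul_bound szsi szG) _.
  by move: Dt; nia.
have {}cardZ : (#|Z| <= (t + D) * Q + (t + D * t))%N by rewrite -ltnS (leq_trans cardZ).
by move: (#|Z|) cardZ Dt => z; rewrite Qt; nia.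
Qed.

End Stepanov.

(** By Euler's criterion this is the quadratic character of a finite field with 2n + 1 elements;
    keeping n explicit allows subfields of [K]. *)
Definition qsign (K : fieldType) n (y : K) : algC :=
  if y == 0 then 0 else if y ^+ n == 1 then 1 else -1.

Lemma qsignM (K : fieldType) n (x y : K) :
    (x != 0 -> x ^+ n.*2 = 1) -> (y != 0 -> y ^+ n.*2 = 1) ->
  qsign n (x * y) = qsign n x * qsign n y.
Proof.
rewrite /qsign mulf_eq0; case: eqVneq => [_ _ _|_ /(_ isT) xn]; first by rewrite mul0r.
case: eqVneq => [_ _|_ /(_ isT) yn]; first by rewrite mulr0.
rewrite exprMn /=; move: xn yn; rewrite -!muln2 !exprM.
move=> /eqP; rewrite sqrf_eq1 => xn /eqP; rewrite sqrf_eq1 => yn.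
have [/eqP ->|] := ifPn (x ^+ n == 1); first by rewrite !mul1r.
case/orP: xn => /eqP -> //; first by rewrite eqxx.
have [/eqP ->|] := ifPn (y ^+ n == 1); first by rewrite !mulr1 => /negPf ->.
case/orP: yn => /eqP -> //; first by rewrite eqxx.
by rewrite mulrNN mulr1 eqxx mulrNN mulr1.
Qed.

(** Upper bounds for both signs suffice: the two counts add up to at least Q^2 - D, so they differ
    by at most 3DQ + D. *)
Lemma stepanov_sum (K : finFieldType) p mu t D (F : {poly K}) :
    p \in [pchar K] -> (p ^ mu = t.*2.+1)%N -> (0 < D <= t)%N ->
    coprimep F F^`() -> size F = D.+1 -> F.[0] != 0 ->
    #|[set x : K | x ^+ (p ^ mu * p ^ mu) == x]| = (p ^ mu * p ^ mu)%N ->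
    (forall x, x ^+ (p ^ mu * p ^ mu) = x -> F.[x] ^+ (p ^ mu * p ^ mu) = F.[x]) ->
  `|\sum_(x | x ^+ (p ^ mu * p ^ mu) == x) qsign (t * t.+1).*2 F.[x]| <= (4 * D * p ^ mu)%:R.
Proof.
move=> pchK Qt Dt sepF szF F0; set Q := (p ^ mu)%N => cardq Fq; set h := (t * t.+1).*2.
have qE : (Q * Q = h.*2.+1)%N by rewrite /Q Qt /h; lia.
pose Z e := [set x : K | (x ^+ (Q * Q) == x) && (F.[x] ^+ h == e)].
have F00 : F != 0 by rewrite -size_poly_gt0 szF.
have h0 : (0 < h)%N by rewrite /h double_gt0 muln_gt0 andbT; case/andP: Dt; apply: leq_trans.
pose Z0 := Z 0; pose Zp := Z 1; pose Zm := Z (-1).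
have cZ0 : (#|Z0| <= D)%N.
  rewrite -ltnS -szF cardE; apply: max_poly_roots => //; last exact: enum_uniq.
  apply/allP => x; rewrite mem_enum inE => /andP[_]; rewrite expf_eq0 h0 /=.
  by [].
have nm1 : (-1 : K) != 1.
  rewrite eq_sym -subr_eq0 opprK -(natrD _ 1 1) -(dvdn_pcharf pchK).
  rewrite dvdn_prime2 ?(pcharf_prime pchK) //.
  apply/negP => /eqP p2; move: Qt; rewrite p2; case: (mu) => [|m].
    by rewrite expn0; move: Dt; lia.
  by rewrite expnS; lia.
have tri x : x ^+ (Q * Q) = x ->
    [\/ F.[x] = 0, F.[x] != 0 /\ F.[x] ^+ h = 1 | F.[x] != 0 /\ F.[x] ^+ h = -1].
  move=> /Fq; rewrite qE exprSr; have [->|y0] := eqVneq F.[x] 0; first by constructor 1.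
  rewrite -[RHS]mul1r => /(mulIf y0)/eqP; rewrite -muln2 exprM sqrf_eq1.
  by case/orP => /eqP; [constructor 2|constructor 3].
have cZ (e : K) : #|Z e| = (\sum_(x | x ^+ (Q * Q) == x) (F.[x] ^+ h == e))%N.
  rewrite -sum1_card big_mkcond [RHS]big_mkcond; apply: eq_bigr => x _.
  by rewrite inE; case: (_ == x); case: (_ == e).
have ZE : (#|Z0| + #|Zp| + #|Zm| = Q * Q)%N.
  rewrite /Z0 /Zp /Zm !cZ -!big_split /= -[RHS]cardq -[RHS]sum1_card.
  apply: eq_big => [x|x /eqP xq]; first by rewrite inE.
  case: (tri x xq) => [->|[y0 ->]|[y0 ->]].
  - by rewrite expr0n gtn_eqF // eqxx [0 == 1]eq_sym oner_eq0 eq_sym oppr_eq0 oner_eq0.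
  - by rewrite oner_eq0 eqxx [1 == -1]eq_sym (negPf nm1).
  - by rewrite oppr_eq0 oner_eq0 (negPf nm1) eqxx.
have SE : \sum_(x | x ^+ (Q * Q) == x) qsign h F.[x] = #|Zp|%:R - #|Zm|%:R.
  rewrite /Zp /Zm !cZ !natr_sum -sumrB; apply: eq_bigr => x /eqP xq; rewrite /qsign.
  case: (tri x xq) => [->|[y0 ->]|[y0 ->]].
  - by rewrite eqxx expr0n gtn_eqF // [0 == 1]eq_sym oner_eq0 eq_sym oppr_eq0 oner_eq0 subrr.
  - by rewrite (negPf y0) eqxx [1 == -1]eq_sym (negPf nm1) subr0.
  - by rewrite (negPf y0) (negPf nm1) eqxx sub0r.
have bZ e : (2 * #|Z e| <= Q * Q + 3 * D * Q)%N by apply: stepanov_bound.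
rewrite SE; have Q0 : (0 < Q)%N by rewrite /Q Qt.
have D4 : (D <= D * Q)%N by rewrite leq_pmulr.
have bp := bZ 1; have bm := bZ (-1); rewrite -/Zp -/Zm in bp bm.
have [le10|lt01] := leqP #|Zm| #|Zp|.
  rewrite -natrB // normr_nat ler_nat.
  by move: (#|Z0|) (#|Zp|) (#|Zm|) cZ0 ZE le10 D4 bp bm => a b c; nia.
rewrite distrC -natrB 1?ltnW // normr_nat ler_nat.
by move: (#|Z0|) (#|Zp|) (#|Zm|) cZ0 ZE lt01 D4 bp bm => a b c; nia.
Qed.

Definition twist_poly (K : fieldType) d (x : K) (C : seq K) : {poly K} :=
  \prod_(c <- C) (c%:P - x *: 'X^d).

(** Each factor is separable because c and d are nonzero in [K], and two factors differ by a nonzero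
    constant. *)
Lemma twist_poly_facts (K : fieldType) d (x : K) (C : seq K) :
    (d%:R : K) != 0 -> x != 0 -> uniq C -> 0 \notin C ->
  [/\ separable_poly (twist_poly d x C), size (twist_poly d x C) = (size C * d).+1
    & (twist_poly d x C).[0] != 0].
Proof.
move=> nd x0; have d0 : (0 < d)%N by rewrite lt0n; apply: contraNneq nd => ->.
pose f (c : K) := c%:P - x *: 'X^d.
have szf c : size (f c) = d.+1.
  rewrite /f addrC size_polyDl size_polyN size_scale // size_polyXn // ltnS.
  exact: leq_trans (size_polyC_leq1 _) _.
have f0 c : f c != 0 by rewrite -size_poly_gt0 szf.
have sepf c : c != 0 -> separable_poly (f c).
  move=> c0; rewrite unlock coprimep_sym.
  (* Explicit Bezout relation between the factor and its derivative. *)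
  have fE : (- d%:R^-1 *: 'X) * (f c)^`() + f c = c *: 1.
    have -> : (f c)^`() = (- (x * d%:R)) *: 'X^(d.-1).
      by rewrite /f derivB derivC derivZ derivXn sub0r -scaler_nat scalerA scaleNr.
    rewrite -scalerAl -scalerAr scalerA mulrNN -exprS prednK // [x * _]mulrC mulKf //.
    by rewrite /f addrCA subrr addr0 alg_polyC.
  by rewrite -(coprimep_addl_mul (- d%:R^-1 *: 'X)) fE coprimepZr // coprimep1.
have copf c c' : c != c' -> coprimep (f c) (f c').
  move=> cc; rewrite -(coprimep_addl_mul (-1)).
  rewrite (_ : _ + _ = (c' - c) *: 1) ?coprimepZr ?coprimep1 //; first by rewrite subr_eq0 eq_sym.
  by rewrite mulN1r /f alg_polyC polyCB; ring.
elim: C => [|c C IHC] /=.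
  move=> _ _; rewrite /twist_poly big_nil size_poly1 hornerC oner_eq0; split=> //.
  by rewrite unlock coprime1p.
rewrite inE negb_or eq_sym => /andP[cC UC] /andP[c0 C0].
have [sepC szC zC] := IHC UC C0; rewrite /twist_poly big_cons -/(f c) -/(twist_poly d x C).
have T0 : twist_poly d x C != 0 by rewrite -size_poly_gt0 szC.
split.
- rewrite separable_mul sepf // sepC /=.
  rewrite /twist_poly big_seq; elim/big_rec: _ => [|c' P c'C cop]; first exact: coprimep1.
  rewrite coprimepMr cop andbT; apply: copf.
  by apply: contraNneq cC => ->.
- by rewrite size_mul // szf szC addSn /= mulSn addnS.
- rewrite hornerM mulf_neq0 // /f hornerD hornerN hornerZ hornerXn hornerC expr0n gtn_eqF //.
  by rewrite mulr0 subr0.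
Qed.

Lemma qsign_prod (K : fieldType) n (I : Type) (s : seq I) (f : I -> K) :
    (forall i, f i != 0 -> f i ^+ n.*2 = 1) ->
  qsign n (\prod_(i <- s) f i) = \prod_(i <- s) qsign n (f i).
Proof.
move=> fn; elim: s => [|i s IHs].
  by rewrite !big_nil /qsign oner_eq0 expr1n eqxx.
rewrite !big_cons qsignM ?IHs //; first exact: fn.
elim: s {IHs} => [|j s IHs]; first by rewrite big_nil expr1n.
rewrite big_cons mulf_eq0 negb_or => /andP[/fn fj /IHs ps].
by rewrite exprMn fj ps mulr1.
Qed.

(** * Averaging over the twisted curves *)

Section OrbitSumBound.

Variables (p : nat) (K : finFieldType) (iota : {rmorphism 'F_p -> K}).
Hypotheses (pr_p : prime p) (odd_p : odd p).
Variables (chi : 'F_p -> algC) (C : seq 'F_p).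
Hypotheses (chi0 : chi 0 = 0) (chi1 : forall x, `|chi x| <= 1).
Hypotheses (UC : uniq C) (C0 : 0 \notin C) (Cn : (0 < size C)%N).

Definition chi_qsign (h : {poly 'F_p}) : algC :=
  chi h.[0] * \prod_(c <- C) qsign p./2 h.[c].

Variables (mu t : nat).
Hypotheses (Qt : (p ^ mu = t.*2.+1)%N) (Dt : (size C * p.-1 <= t)%N).
Hypothesis cardK : #|[set x : K | x ^+ (p ^ mu.*2) == x]| = (p ^ mu.*2)%N.

(** With q = p^(2 mu), [E] is the exponent of the norm from F_q to F_p and [H] is (q - 1)/2. *)
Local Notation E := (\sum_(i < mu.*2) p ^ i)%N.
Local Notation H := (t * t.+1).*2.
Local Notation D := (size C * p.-1)%N.

Let p1 : (0 < p.-1)%N. Proof. by rewrite -subn1 subn_gt0 prime_gt1. Qed.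
Let qE : (p ^ mu.*2 = p ^ mu * p ^ mu)%N. Proof. by rewrite -addnn expnD. Qed.
Let qH : (p ^ mu.*2 = H.*2.+1)%N. Proof. by rewrite qE Qt; lia. Qed.
Let EpH : (E * p.-1 = H.*2)%N.
Proof. by rewrite mulnC -predn_exp qH. Qed.
Let pE : p.-1 = p./2.*2.
Proof. by rewrite -[in LHS](odd_double_half p) odd_p. Qed.
Let EH : (E * p./2 = H)%N.
Proof. by apply: double_inj; rewrite -EpH pE -doubleMr. Qed.

Let t0 : (0 < t)%N. Proof. by apply: leq_trans Dt; rewrite muln_gt0 Cn. Qed.
Let H0 : (0 < H)%N. Proof. by rewrite double_gt0 muln_gt0 t0. Qed.
Let E0 : (0 < E)%N. Proof. by have := H0; rewrite -double_gt0 -EpH muln_gt0 => /andP[]. Qed.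

Let pow_H (y : K) : y ^+ (p ^ mu.*2) = y -> y != 0 -> y ^+ H.*2 = 1.
Proof. by rewrite qH exprSr => /eqP + y0; rewrite -[X in _ == X]mul1r => /eqP /(mulIf y0). Qed.

Let fixB (x y : K) : x ^+ (p ^ mu.*2) = x -> y ^+ (p ^ mu.*2) = y ->
  (x - y) ^+ (p ^ mu.*2) = x - y.
Proof. by rewrite -!(iter_frob iota pr_p) iter_frobB => -> ->. Qed.

Let fix_iota a : iota a ^+ (p ^ mu.*2) = iota a.
Proof. by rewrite -(iter_frob iota pr_p) iter_frob_iota. Qed.

Let descend_fix y : y ^+ (p ^ mu.*2) = y -> iota (descend iota (y ^+ E)) = y ^+ E.
Proof.
move=> yq; apply: descendK => //; have [->|y0] := eqVneq y 0.
  by rewrite [0 ^+ E]expr0n (gtn_eqF E0) expr0n gtn_eqF ?prime_gt0.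
rewrite -[X in _ ^+ X](prednK (prime_gt0 pr_p)) exprS -exprM EpH pow_H //.
by rewrite mulr1.
Qed.

(** The quadratic character of F_p composed with the norm is that of F_q, since E (p - 1)/2 = H. *)
Let qsign_descend y : y ^+ (p ^ mu.*2) = y ->
  qsign p./2 (descend iota (y ^+ E)) = qsign H y.
Proof.
move=> yq; rewrite /qsign -(fmorph_eq0 iota) -(inj_eq (fmorph_inj iota)) rmorphXn rmorph1 /=.
by rewrite descend_fix // -exprM EH expf_eq0 E0.
Qed.

Let chi_qsign_orbit x : x ^+ (p ^ mu.*2) = x ->
  chi_qsign (orbit_poly iota pr_p mu.*2 x) =
    chi (descend iota ((- x) ^+ E)) * qsign H (\prod_(c <- C) (iota c - x)).
Proof.
move=> xq; rewrite /chi_qsign horner_orbit_poly // rmorph0 sub0r; congr (_ * _).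
rewrite qsign_prod => [|c]; last by apply: pow_H; apply: fixB.
apply: eq_bigr => c _; rewrite horner_orbit_poly // qsign_descend //.
exact: fixB.
Qed.

(** The element u^(p-1) has norm 1, so the twist leaves the [chi] factor unchanged; hence the
    exponent [p.-1]. *)
Let twist_orbit x u : x ^+ (p ^ mu.*2) = x -> u ^+ (p ^ mu.*2) = u -> u != 0 ->
  chi_qsign (orbit_poly iota pr_p mu.*2 (x * u ^+ p.-1)) =
    chi (descend iota ((- x) ^+ E)) * qsign H (twist_poly p.-1 x (map iota C)).[u].
Proof.
move=> xq uq u0; rewrite chi_qsign_orbit; last by rewrite exprMn xq exprAC uq.
congr (_ * _).
  congr (chi _); congr (descend _ _).
  by rewrite -mulNr exprMn -exprM mulnC EpH pow_H // mulr1.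
congr (qsign _ _); rewrite /twist_poly big_map horner_prod; apply: eq_bigr => c _.
by rewrite hornerD hornerN hornerZ hornerXn hornerC.
Qed.

Let pchK : p \in [pchar K]. Proof. exact: pchar_ext iota pr_p. Qed.

Let twist_bound x : x ^+ (p ^ mu.*2) = x -> x != 0 ->
  `|\sum_(u | u ^+ (p ^ mu.*2) == u) qsign H (twist_poly p.-1 x (map iota C)).[u]|
    <= (4 * D * p ^ mu)%:R.
Proof.
move=> xq x0; have nd : (p.-1%:R : K) != 0.
  rewrite -(dvdn_pcharf pchK) gtnNdvd // ltn_predL prime_gt0 //.
have [||sepF szF F0] := @twist_poly_facts K p.-1 x (map iota C) nd x0.
- by rewrite map_inj_uniq //; apply: fmorph_inj.
- by rewrite -(rmorph0 iota) mem_map //; apply: fmorph_inj.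
rewrite size_map in szF; rewrite qE; apply: (stepanov_sum pchK Qt _ _ szF F0).
- by rewrite Dt muln_gt0 Cn p1.
- by move: sepF; rewrite unlock.
- by rewrite -qE cardK.
move=> u; rewrite -qE => uq; rewrite /twist_poly big_map horner_prod -prodrXl.
apply: eq_bigr => c _; rewrite hornerD hornerN hornerZ hornerXn hornerC.
by apply: fixB => //; rewrite exprMn xq exprAC uq.
Qed.

(** For each nonzero u, x -> x u^(p-1) permutes the nonzero elements of F_q. Summing over all q - 1
    such u and exchanging sums leaves, for each x, a quadratic character sum in u bounded by
    [twist_bound]. *)
Lemma orbit_sum_bound :
  `|orbit_sum iota pr_p chi_qsign mu.*2| <= (5 * D * p ^ mu)%:R.
Proof.
set q := (p ^ mu.*2)%N; set S := orbit_sum _ _ _ _.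
pose U := [set u : K | (u ^+ q == u) && (u != 0)].
have q1 : (1 < q)%N by rewrite /q qH ltnS double_gt0.
have cardU : #|U| = q.-1.
  have := cardsD1 0 [set x : K | x ^+ q == x].
  rewrite cardK inE expr0n gtn_eqF ?eqxx ?(ltnW q1) // add1n => cardq.
  rewrite /q cardq /=.
  by apply: eq_card => u; rewrite !inE andbC.
have SE : (q.-1)%:R * S = \sum_(x in U) chi (descend iota ((- x) ^+ E)) *
    \sum_(u in U) qsign H (twist_poly p.-1 x (map iota C)).[u].
  rewrite mulr_natl -cardU -sumr_const.
  transitivity (\sum_(u in U) \sum_(x in U)
     chi_qsign (orbit_poly iota pr_p mu.*2 (x * u ^+ p.-1))).
    apply: eq_bigr => u; rewrite inE => /andP[/eqP uq u0].
    have -> : S = \sum_(x in U) chi_qsign (orbit_poly iota pr_p mu.*2 x).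
      rewrite /S /orbit_sum (bigD1 0) /=; last by rewrite expr0n gtn_eqF ?(ltnW q1).
      rewrite chi_qsign_orbit; last by rewrite expr0n gtn_eqF ?(ltnW q1).
      rewrite oppr0 expr0n (gtn_eqF E0) /= -[X in descend iota X](rmorph0 iota).
      rewrite iotaK // chi0 mul0r add0r.
      by apply: eq_bigl => x; rewrite inE.
    have ud : u ^+ p.-1 != 0 by rewrite expf_neq0.
    rewrite (reindex_inj (mulIf ud)); apply: eq_bigl => x.
    by rewrite !inE mulf_eq0 negb_or ud andbT exprMn exprAC uq (inj_eq (mulIf ud)).
  rewrite exchange_big; apply: eq_bigr => x; rewrite inE => /andP[/eqP xq x0].
  rewrite mulr_sumr; apply: eq_bigr => u; rewrite inE => /andP[/eqP uq u0].
  exact: twist_orbit.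
have q10 : (0 : algC) < (q.-1)%:R by rewrite ltr0n -ltnS prednK // ltnW.
rewrite -(ler_pM2l q10) -{1}(normr_nat algC) -normrM SE.
apply: le_trans (ler_norm_sum _ _ _) _.
rewrite [leRHS]mulr_natl -cardU -sumr_const; apply: ler_sum => x.
rewrite inE => /andP[/eqP xq x0]; rewrite normrM.
apply: le_trans (ler_piMl _ (chi1 _)) _ => //.
have := twist_bound xq x0; rewrite (bigD1 0) /=; last by rewrite expr0n gtn_eqF ?(ltnW q1).
rewrite [X in `|_ + X|](eq_bigl [in U]); last by move=> u; rewrite inE.
set v := qsign _ _; set w := \sum_(u in U) _ => vw.
have v1 : `|v| <= 1.
  by rewrite /v /qsign; case: ifP; rewrite ?normr0 ?ler01 //; case: ifP; rewrite ?normrN normr1.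
(* Removing the term u = 0 costs at most 1, which turns the factor 4 into 5. *)
have -> : w = (v + w) - v by rewrite addrC addKr.
apply: le_trans (ler_normB _ _) _; apply: le_trans (lerD vw v1) _.
rewrite -(natrD _ _ 1) ler_nat.
have : (0 < D * p ^ mu)%N by rewrite !muln_gt0 Cn p1 expn_gt0 prime_gt0.
by lia.
Qed.

End OrbitSumBound.

(** * The Weil bound *)

Lemma qsign_Fp_M p : prime p -> odd p -> {morph @qsign 'F_p p./2 : x y / x * y}.
Proof.
move=> pr_p odd_p x y.
have pow1 (z : 'F_p) : z != 0 -> z ^+ p./2.*2 = 1.
  move=> z0; have := expf_card z; rewrite card_Fp // -[X in _ ^+ X](odd_double_half p) odd_p exprS.
  by rewrite -[RHS]mulr1 => /(mulfI z0).
by apply: qsignM; apply: pow1.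
Qed.

(** X^((p-1)/2) - 1 has too few roots to vanish at all p - 1 nonzero elements. *)
Lemma exists_nonresidue p : prime p -> odd p ->
  exists2 u : 'F_p, u != 0 & u ^+ p./2 != 1.
Proof.
move=> pr_p odd_p; have h0 : (0 < p./2)%N by have := prime_gt1 pr_p; move: odd_p; lia.
apply/exists_inP; apply: contraT => /exists_inPn all1.
have := @max_poly_roots _ ('X^(p./2) - 1%:P : {poly 'F_p}) (enum [set~ 0]).
rewrite -size_poly_gt0 size_XnsubC // enum_uniq -cardE cardsC1 card_Fp //.
have -> : all (root ('X^(p./2) - 1%:P)) (enum [set~ (0 : 'F_p)]).
  apply/allP => u; rewrite mem_enum !inE => u0.
  by rewrite rootE hornerD hornerN hornerXn hornerC subr_eq0; move/negPn: (all1 u u0).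
by move=> /(_ isT isT isT); rewrite -{1}(odd_double_half p) odd_p; lia.
Qed.

Section Weil.

Variables (p : nat) (chi : 'F_p -> algC) (C : seq 'F_p).
Hypotheses (pr_p : prime p) (odd_p : odd p).
Hypotheses (chiM : {morph chi : x y / x * y}) (chi0 : chi 0 = 0) (chi_1 : chi 1 = 1).
Hypothesis chi1 : forall x, `|chi x| <= 1.
Hypotheses (UC : uniq C) (C0 : 0 \notin C) (Cn : (0 < size C)%N).

Local Notation Lam := (chi_qsign chi C).
Local Notation L := (monic_sum Lam).
Local Notation D := (size C * p.-1)%N.

Let LamM : {morph Lam : a b / a * b}.
Proof.
move=> a b; rewrite /chi_qsign hornerM chiM mulrACA -big_split /=; congr (_ * _).
by apply: eq_bigr => c _; rewrite hornerM qsign_Fp_M.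
Qed.

Let L0 : L 0 = 1.
Proof.
rewrite /monic_sum (bigD1 0) //= big1 ?addr0 => [|v /negP[]]; last by apply/eqP/rowP => -[].
rewrite /monic_of_row linear0 addr0 expr0 /chi_qsign hornerC chi_1 mul1r big1 // => c _.
by rewrite hornerC /qsign oner_eq0 expr1n eqxx.
Qed.

Let L1 : L 1 = \sum_x chi x * \prod_(c <- C) qsign p./2 (x + c).
Proof.
rewrite /monic_sum (reindex (fun a => const_mx a : 'rV['F_p]_1)) /=; last first.
  exists (fun v : 'rV_1 => v 0 0) => [a _|v _]; first by rewrite mxE.
  by apply/rowP => i; rewrite mxE ord1.
apply: eq_bigr => a _; have -> : monic_of_row (const_mx a : 'rV_1) = 'X + a%:P.
  rewrite /monic_of_row; congr (_ + _); apply/polyP => i; rewrite coef_rVpoly coefC.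
  by case: insubP => [j ji <-|]; [rewrite mxE ord1|case: i].
rewrite /chi_qsign hornerD hornerX hornerC add0r; congr (_ * _); apply: eq_bigr => c _.
by rewrite hornerD hornerX hornerC addrC.
Qed.

(** [monic_sum0] at the points 0 :: C, rescaling the value at the first element of C by a
    nonresidue; so [chi] may be principal. *)
Let Lgt k : (size C < k)%N -> L k = 0.
Proof.
move=> Ck; have [u u0 up] := exists_nonresidue pr_p odd_p.
pose a (i : 'I_(size C).+1) := nth 0 (0 :: C) i.
pose psi (i : 'I_(size C).+1) := if i == ord0 then chi else qsign p./2.
have -> : L k = monic_sum (fun h => \prod_i psi i h.[a i]) k.
  apply: eq_bigr => v _; rewrite big_ord_recl /chi_qsign; congr (_ * _).
  by rewrite (big_nth 0) big_mkord; apply: eq_bigr.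
apply: (@monic_sum0 _ _ a psi (lift ord0 (Ordinal Cn)) u) => //.
- move=> i j /eqP; rewrite /a nth_uniq ?ltn_ord //= ?C0 //.
  by move/eqP/val_inj.
- by move=> i x y; rewrite /psi; case: ifP => _; [apply: chiM|apply: qsign_Fp_M].
by rewrite /psi /= /qsign (negPf u0) (negPf up) -subr_eq0 -opprD oppr_eq0 -(natrD _ 1 1) pnatr_eq0.
Qed.

(** The sum is [L 1], that is, minus the sum of at most |C| inverse roots, each of absolute value at
    most sqrt p. *)
Theorem weil_bound :
  `|\sum_x chi x * \prod_(c <- C) qsign p./2 (x + c)| <= (size C)%:R * sqrtC p%:R.
Proof.
have [s szs LE] := split_const1_poly L0 Lgt.
have p0 : (0 : algC) < p%:R by rewrite ltr0n prime_gt0.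
(* The field [K] changes with mu, but [s] does not. The lower bound on mu ensures D <= t. *)
have bound mu : (D.*2.+1 <= mu)%N ->
    `|\sum_(w <- s) w ^+ mu.*2| <= (5 * D)%:R * p%:R ^+ mu.
  move=> Dmu; have [K [iota [split cardK]]] := exists_split_field mu.*2 pr_p.
  pose t := (p ^ mu)./2.
  have Qt : (p ^ mu = t.*2.+1)%N.
    by rewrite -[LHS]odd_double_half oddX odd_p orbT.
  have mu_lt : (mu < p ^ mu)%N by apply: ltn_expl; apply: prime_gt1.
  have Dt : (D <= t)%N by move: mu_lt; rewrite Qt; lia.
  have mu0 : (0 < mu.*2 <= mu.*2)%N by rewrite leqnn double_gt0 andbT; lia.
  have := @orbit_sum_bound p K iota pr_p odd_p chi C chi0 chi1 UC C0 Cn mu t Qt Dt (cardK _ mu0).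
  have NU := newton_unique LE (fun k => @newton_orbit_sum p K iota pr_p Lam _ k LamM split).
  have := NU mu.*2.-1; rewrite prednK; last by case/andP: mu0.
  by move=> -> //; rewrite normrN natrM natrX.
have ws := power_sum_bound p0 bound.
rewrite -L1 LE; have := newton_prod s 0; rewrite /= mulr1n => ->.
rewrite big_ord1 normrN.
have -> : (\prod_(w <- s) (1 - w *: 'X))`_(0 - 0) = 1 by rewrite -LE.
rewrite mulr1; apply: le_trans (ler_norm_sum _ _ _) _.
apply: (@le_trans _ _ (\sum_(w <- s) sqrtC p%:R)).
  rewrite big_seq [leRHS]big_seq; apply: ler_sum => w /ws w2.
  by rewrite expr1 -(@ler_pXn2r _ 2) ?nnegrE ?sqrtC_ge0 ?(ltW p0) // sqrtCK.
rewrite big_const_seq count_predT iter_addr_0 -[_ *+ size s]mulr_natl.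
by apply: ler_wpM2r; rewrite ?sqrtC_ge0 ?(ltW p0) ?ler_nat.
Qed.

End Weil.

(** * The sieve for primitive elements *)

Lemma exists_primitive_root p : prime p -> exists g : 'F_p, (p.-1).-primitive_root g.
Proof.
move=> pr_p; have p1 : (0 < p.-1)%N by rewrite -subn1 subn_gt0 prime_gt1.
have := @has_prim_root _ p.-1 (enum [set~ (0 : 'F_p)]) p1.
rewrite enum_uniq -cardE cardsC1 card_Fp // leqnn.
have -> : all p.-1.-unity_root (enum [set~ (0 : 'F_p)]).
  apply/allP => u; rewrite mem_enum !inE => u0; apply/unity_rootP.
  have := expf_card u; rewrite card_Fp // -[X in _ ^+ X = _ -> _](prednK (prime_gt0 pr_p)) exprS.
  by rewrite -[RHS]mulr1 => /(mulfI u0).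
by case/(_ isT isT isT)/hasP => g _ gP; exists g.
Qed.

Lemma coprime_primes k n : (0 < n)%N ->
  coprime k n = all (fun q => ~~ (q %| k)%N) (primes n).
Proof.
move=> n0; apply/idP/allP => [cop q|H].
  rewrite mem_primes => /and3P[pr_q _ qn]; apply/negP => qk.
  have : (q %| gcdn k n)%N by rewrite dvdn_gcd qk.
  by rewrite (eqP cop) dvdn1 => /eqP q1; rewrite q1 in pr_q.
apply/negPn/negP => ncop.
have g1 : (1 < gcdn k n)%N by rewrite ltn_neqAle eq_sym [_ == _](negPf ncop) gcdn_gt0 n0 orbT.
have /H/negP[] : pdiv (gcdn k n) \in primes n.
  by rewrite mem_primes pdiv_prime // n0 (dvdn_trans (pdiv_dvd _)) ?dvdn_gcdr.
by rewrite (dvdn_trans (pdiv_dvd _)) ?dvdn_gcdl.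
Qed.

(** Products of subsets of the primes of n are distinct square-free divisors. *)
Lemma leq_exp_primes_W n : (0 < n)%N -> (2 ^ size (primes n) <= W n)%N.
Proof.
move=> n0.
pose D := foldr (fun q l => l ++ [seq (q * d)%N | d <- l]) [:: 1%N].
have szD s : size (D s) = (2 ^ size s)%N.
  by elim: s => //= q s IHs; rewrite size_cat size_map IHs expnS mul2n addnn.
(* The clause on prime divisors keeps the new prime q from dividing earlier products. *)
have key s : uniq s -> {subset s <= primes n} ->
    uniq (D s) /\ forall d, d \in D s ->
      [/\ squarefree d, (d %| n)%N & forall q, prime q -> (q %| d)%N -> q \in s].
  elim: s => [|q s IHs] /=.
    move=> _ _; split=> // d; rewrite inE => /eqP->; split=> // q pr_q.
    by rewrite dvdn1 => /eqP q1; rewrite q1 in pr_q.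
  move=> /andP[qs Us] sub; have [|UD DE] := IHs Us.
    by move=> r rs; apply: sub; rewrite inE rs orbT.
  have /[!mem_primes] /and3P[pr_q _ qn] : q \in primes n by apply: sub; rewrite inE eqxx.
  have nqd d : d \in D s -> ~~ (q %| d)%N.
    by case/DE => _ _ /(_ q pr_q) Hd; apply: contra qs.
  split.
    rewrite cat_uniq UD map_inj_uniq ?UD ?andbT /=; last first.
      by move=> d d' /eqP; rewrite eqn_pmul2l ?prime_gt0 // => /eqP.
    by apply/hasPn => _ /mapP[d _ ->]; apply/negP => /nqd; rewrite dvdn_mulr.
  move=> d; rewrite mem_cat => /orP[/DE[sq dn Hd]|/mapP[d' d's ->]].
    by split=> // r pr_r rd; rewrite inE Hd ?orbT.
  have [/andP[d'0 /allP sq] d'n Hd'] := DE _ d's; have nq := nqd _ d's.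
  have q0 := prime_gt0 pr_q; split.
  - rewrite /squarefree muln_gt0 q0 d'0 /=; apply/allP => r.
    rewrite primesM // primes_prime // inE lognM // logn_prime //.
    case: eqVneq => [->|rq] /= r_in; first by rewrite (lognE q d') (negPf nq) !andbF addn0 eqxx.
    by rewrite add0n; apply: sq.
  - by rewrite Gauss_dvd ?qn ?d'n // prime_coprime.
  - move=> r pr_r; rewrite Euclid_dvdM // inE dvdn_prime2 // => /orP[->//|/(Hd' _ pr_r) ->].
    by rewrite orbT.
have [UD DE] := key _ (primes_uniq n) (fun q => id).
rewrite /W -size_filter -szD; apply: uniq_leq_size => // d /DE[sq dn _].
by rewrite mem_filter sq -dvdn_divisors.
Qed.

Section Sieve.

Variables (p : nat) (g : 'F_p).
Hypotheses (pr_p : prime p) (gP : (p.-1).-primitive_root g).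

Let p1 : (0 < p.-1)%N. Proof. by rewrite -subn1 subn_gt0 prime_gt1. Qed.

(** The default 0 is met only at x = 0, where [dchar] vanishes. *)
Definition dlog (x : 'F_p) : nat :=
  if [pick i : 'I_p.-1 | g ^+ i == x] is Some i then i else 0%N.

Lemma dlogK x : x != 0 -> g ^+ dlog x = x.
Proof.
move=> x0; have xp : x ^+ p.-1 = 1.
  have := expf_card x; rewrite card_Fp // -[X in _ ^+ X = _ -> _](prednK (prime_gt0 pr_p)) exprS.
  by rewrite -[RHS]mulr1 => /(mulfI x0).
rewrite /dlog; case: pickP => [i /eqP //|none].
by have [i xi] := prim_rootP gP xp; have := none i; rewrite xi eqxx.
Qed.

(** As w runs over the (p-1)-th roots of unity, these are all the multiplicative characters of
    F_p. *)
Definition dchar (w : algC) (x : 'F_p) : algC := if x == 0 then 0 else w ^+ dlog x.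

Lemma dcharM w : w ^+ p.-1 = 1 -> {morph dchar w : x y / x * y}.
Proof.
move=> wp x y; rewrite /dchar mulf_eq0.
case: eqVneq => [_|x0]; first by rewrite mul0r.
case: eqVneq => [_|y0] /=; first by rewrite mulr0.
have /eqP : g ^+ dlog (x * y) = g ^+ (dlog x + dlog y).
  by rewrite exprD !dlogK // mulf_neq0.
rewrite (eq_prim_root_expr gP) -exprD => /eqP E.
by rewrite -(expr_mod _ wp) E expr_mod.
Qed.

Lemma dchar_1 w : w ^+ p.-1 = 1 -> dchar w 1 = 1.
Proof.
move=> wp; rewrite /dchar oner_eq0 -(expr_mod _ wp).
have /eqP : g ^+ dlog 1 = g ^+ 0 by rewrite dlogK ?oner_eq0.
by rewrite (eq_prim_root_expr gP) => /eqP ->; rewrite mod0n.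
Qed.

Lemma dchar_norm w x : w ^+ p.-1 = 1 -> `|dchar w x| <= 1.
Proof.
move=> wp; rewrite /dchar; case: ifP => _; first by rewrite normr0 ler01.
have /eqP w1 : `|w| == 1 by rewrite -(pexpr_eq1 p1) // -normrX wp normr1.
by rewrite normrX w1 expr1n.
Qed.

(* Inclusion-exclusion one prime at a time; each step detects q | dlog x by the q-th roots of unity
   and hence doubles the bound. *)
Lemma sieve_bound (G : 'F_p -> algC) (M : algC) (s : seq nat) :
    (forall w, w ^+ p.-1 = 1 -> `|\sum_x dchar w x * G x| <= M) ->
    all (fun q => (0 < q) && (q %| p.-1))%N s ->
  forall w, w ^+ p.-1 = 1 ->
    `|\sum_(x | all (fun q => ~~ (q %| dlog x)%N) s) dchar w x * G x| <= (2 ^ size s)%:R * M.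
Proof.
move=> GM; elim: s => [|q s IHs] /= => [_ w wp|/andP[/andP[q0 qp] sp] w wp].
  by rewrite mul1r; apply: GM.
set A := fun x => all (fun q => ~~ (q %| dlog x)%N) s.
have [z zP] := C_prim_root_exists q0.
(* Since q divides p - 1, twisting by z^j gives another admissible character. *)
have zp j : (w * z ^+ j) ^+ p.-1 = 1.
  rewrite exprMn wp mul1r -exprM mulnC exprM.
  by case/dvdnP: qp => d ->; rewrite mulnC exprM (prim_expr_order zP) !expr1n.
have ind x : \sum_(j < q) (z ^+ dlog x) ^+ j = if (q %| dlog x)%N then q%:R else 0.
  case: ifP => [|ndv].
    rewrite (prim_order_dvd zP) => /eqP ->; under eq_bigr do rewrite expr1n.
    by rewrite sumr_const card_ord.
  have nz : z ^+ dlog x - 1 != 0 by rewrite subr_eq0 -(prim_order_dvd zP) ndv.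
  apply: (mulfI nz); rewrite -subrX1 -exprM mulnC exprM (prim_expr_order zP) expr1n.
  by rewrite subrr mulr0.
have q0C : (q%:R : algC) != 0 by rewrite pnatr_eq0 -lt0n.
have -> : \sum_(x | ~~ (q %| dlog x)%N && A x) dchar w x * G x =
    \sum_(x | A x) dchar w x * G x -
      q%:R^-1 * \sum_(j < q) \sum_(x | A x) dchar (w * z ^+ j) x * G x.
  rewrite exchange_big /= mulr_sumr -sumrB big_mkcondl; apply: eq_bigr => x _.
  rewrite -mulr_suml.
  have -> : \sum_(j < q) dchar (w * z ^+ j) x = dchar w x * (if (q %| dlog x)%N then q%:R else 0).
    rewrite -ind mulr_sumr; apply: eq_bigr => j _; rewrite /dchar.
    case: ifP => _; first by rewrite mul0r.
    by rewrite exprMn -!exprM [(j * _)%N]mulnC.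
  case: (q %| dlog x)%N => /=; last by rewrite mulr0 mul0r mulr0 subr0.
  by rewrite [dchar w x * q%:R]mulrC -mulrA mulKf // subrr.
apply: le_trans (ler_normB _ _) _; rewrite expnS mul2n -addnn natrD mulrDl.
apply: lerD; first exact: IHs.
rewrite normrM normfV normr_nat mulrC ler_pdivrMr ?ltr0n // mulrC.
apply: le_trans (ler_norm_sum _ _ _) _.
apply: le_trans (ler_sum _ (fun (j : 'I_q) _ => IHs sp _ (zp j))) _.
by rewrite sumr_const card_ord -[_ *+ q]mulr_natl.
Qed.

Lemma primitive_eltsE x :
  (x \in primitive_elts p) = (x != 0) && all (fun q => ~~ (q %| dlog x)%N) (primes p.-1).
Proof.
rewrite inE; have [->|x0] := eqVneq x 0.
  by apply/negP => /prim_expr_order/eqP; rewrite expr0n gtn_eqF // eq_sym oner_eq0.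
by rewrite -{1}(dlogK x0) (prim_root_exp_coprime _ gP) coprime_primes.
Qed.

Lemma card_primitive_elts : #|primitive_elts p| = totient p.-1.
Proof.
rewrite totient_count_coprime big_mkord.
rewrite -sum1_card -[RHS]big_mkcond /=.
pose f (i : 'I_p.-1) := g ^+ i.
have injf : injective f.
  move=> i j /eqP; rewrite (eq_prim_root_expr gP) !modn_small // => /eqP; exact: val_inj.
have -> : primitive_elts p = f @: [set i : 'I_p.-1 | coprime p.-1 i].
  apply/setP => x; rewrite inE; apply/idP/imsetP => [xP|[i + ->]].
    have [i xi] := prim_rootP gP (prim_expr_order xP); exists i => //.
    by rewrite inE coprime_sym -(prim_root_exp_coprime _ gP) -xi.
  by rewrite inE coprime_sym -(prim_root_exp_coprime _ gP).
rewrite sum1_card card_imset // -sum1_card; apply: eq_bigl => i; rewrite inE.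
by [].
Qed.

(** The sieve at w = 1, whose character is the indicator of the nonzero elements. *)
Lemma sum_primitive_bound (G : 'F_p -> algC) (M : algC) :
    (forall w, w ^+ p.-1 = 1 -> `|\sum_x dchar w x * G x| <= M) ->
  `|\sum_(x in primitive_elts p) G x| <= (W p.-1)%:R * M.
Proof.
move=> GM; have M0 : 0 <= M by apply: le_trans (GM 1 (expr1n _ _)).
have sp : all (fun q => (0 < q) && (q %| p.-1))%N (primes p.-1).
  by apply/allP => q; rewrite mem_primes => /and3P[/prime_gt0 -> _ ->].
have := sieve_bound GM sp (expr1n _ _).
have -> : \sum_(x | all (fun q => ~~ (q %| dlog x)%N) (primes p.-1)) dchar 1 x * G x =
    \sum_(x in primitive_elts p) G x.
  rewrite big_mkcond [RHS]big_mkcond; apply: eq_bigr => x _; rewrite primitive_eltsE /dchar.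
  case: eqVneq => _ /=; first by rewrite mul0r; case: ifP.
  by rewrite expr1n mul1r.
move/le_trans; apply; apply: ler_wpM2r => //.
by rewrite ler_nat leq_exp_primes_W.
Qed.

End Sieve.

(** * Sumsets *)

(** The order p - 1 of x does not divide (p - 1)/2, so x is a nonresidue. *)
Lemma primitive_qsign p (x : 'F_p) : prime p -> (3 < p)%N -> x \in primitive_elts p ->
  qsign p./2 x = -1.
Proof.
move=> pr_p p3; rewrite inE => xP.
have p1 : (0 < p.-1)%N by rewrite -subn1 subn_gt0 prime_gt1.
have x0 : x != 0.
  apply: contraL xP => /eqP ->; apply/negP => /prim_expr_order/eqP.
  by rewrite expr0n gtn_eqF // eq_sym oner_eq0.
rewrite /qsign (negPf x0) -(prim_order_dvd xP) gtnNdvd //; move: p3; lia.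
Qed.

Section SquareShifts.

Variables (p : nat).
Hypotheses (pr_p : prime p) (p3 : (3 < p)%N).

Local Notation P := (primitive_elts p).
Local Notation eta := (@qsign 'F_p p./2).

Lemma primitive_qsign_bound (C : seq 'F_p) : uniq C -> 0 \notin C -> (0 < size C)%N ->
  `|\sum_(x in P) \prod_(c <- C) eta (x + c)| <= (W p.-1)%:R * ((size C)%:R * sqrtC p%:R).
Proof.
move=> UC C0 Cn; have [g gP] := exists_primitive_root pr_p.
have odd_p : odd p by case: (even_prime pr_p) p3 => [->|].
apply: (sum_primitive_bound pr_p gP) => w wp; apply: (@weil_bound p (dchar g w) C) => //.
- exact: (dcharM pr_p gP wp).
- exact: (dchar_1 pr_p gP wp).
- by move=> x; apply: dchar_norm.
Qed.

(* Peeling off one factor 1 + eta replaces (C, C') by the two pairs (C \ c, C') and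
   (C \ c, c :: C'); the recursion for the bound solves to 2^m r + m 2^(m-1) with m = |C| and
   r = |C'|. *)
Lemma square_shift_count (C C' : seq 'F_p) : uniq (C ++ C') -> 0 \notin C ++ C' ->
  `|\sum_(x in P) (\prod_(c <- C) (1 + eta (x + c))) * \prod_(c <- C') eta (x + c)
    - (if C' is [::] then (totient p.-1)%:R else 0)| *+ 2
  <= (2 ^ size C * ((size C').*2 + size C))%:R * ((W p.-1)%:R * sqrtC p%:R).
Proof.
have p0 : (0 : algC) <= sqrtC p%:R by rewrite sqrtC_ge0.
elim: C C' => [|c C IHC] C' /= UC C0.
  under eq_bigr do rewrite big_nil mul1r.
  case: C' UC C0 => [|c' C'] UC C0.
    under eq_bigr do rewrite big_nil.
    have [g gP] := exists_primitive_root pr_p.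
    by rewrite sumr_const (card_primitive_elts gP) subrr normr0 mul0rn mulr_ge0 ?mulr_ge0.
  rewrite subr0 addn0 mul1n -mul2n natrM -[_ *+ 2]mulr_natl -mulrA ler_wpM2l //.
  apply: le_trans (primitive_qsign_bound UC C0 _) _ => //.
  by rewrite mulrCA.
move: UC C0 => /= /andP[cC UC]; rewrite inE negb_or => /andP[c0 C0].
have U2 : uniq (C ++ c :: C').
  by rewrite -cat1s uniq_catCA /= cC UC.
have C02 : 0 \notin C ++ c :: C'.
  by move: C0; rewrite !mem_cat inE !negb_or c0 => /andP[-> ->].
have b1 := IHC _ UC C0; have b2 := IHC _ U2 C02; rewrite /= subr0 in b2.
set S1 := \sum_(x in P) _ in b1; set S2 := \sum_(x in P) _ in b2.
have -> : \sum_(x in P) \prod_(c1 <- c :: C) (1 + eta (x + c1)) * \prod_(c1 <- C') eta (x + c1)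
    = S1 + S2.
  rewrite -big_split /=; apply: eq_bigr => x _; rewrite !big_cons.
  by rewrite mulrDl mul1r mulrDl; congr (_ + _); rewrite mulrCA mulrA.
set e := (if C' is [::] then _ else _) in b1 *.
rewrite addrAC; apply: (@le_trans _ _ ((`|S1 - e| + `|S2|) *+ 2)).
  by rewrite lerMn2r ler_normD orbT.
rewrite mulrnDl; apply: le_trans (lerD b1 b2) _.
(* With m = |C| and r = |C'|: 2^m (2r + m) + 2^m (2(r+1) + m) = 2^(m+1) (2r + m + 1). *)
rewrite -mulrDl -natrD ler_wpM2r ?mulr_ge0 // ler_nat expnS.
by move: (2 ^ size C)%N => z; nia.
Qed.

(** Otherwise each x in P has some x + c in P, where 1 + eta vanishes; all products are then 0, and
    [square_shift_count] with empty C' contradicts the hypothesis. *)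
Lemma exists_square_shift (C : seq 'F_p) : uniq C -> 0 \notin C ->
    (2 ^ size C * size C)%:R * ((W p.-1)%:R * sqrtC p%:R) < (totient p.-1)%:R *+ 2 :> algC ->
  exists2 x, x \in P & forall c, c \in C -> x + c \notin P.
Proof.
move=> UC C0 lt_phi.
suff [x xP /allP xC] : exists2 x, x \in P & all (fun c => x + c \notin P) C by exists x.
apply/exists_inP; apply: contraT => /exists_inPn noshift.
have := @square_shift_count C [::]; rewrite cats0 big1 => [/(_ UC C0)|x xP].
  rewrite sub0r normrN normr_nat add0n => le_phi.
  by have := lt_le_trans lt_phi le_phi; rewrite ltxx.
have /allPn[c cC /negPn xcP] := noshift x xP.
rewrite (big_rem c cC) /= primitive_qsign // subrr !mul0r //.
Qed.

End SquareShifts.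

(** The two square roots live in different fields; squaring passes through the integer inequality (a
    c)^2 p < b^2. *)
Lemma sqrt_bound_algC (R : rcfType) (a b c p : nat) : (0 < c)%N -> (0 < p)%N ->
    a%:R < b%:R / (c%:R * Num.sqrt (p%:R : R)) ->
  a%:R * (c%:R * sqrtC p%:R) < b%:R :> algC.
Proof.
move=> c0 p0; have sp : 0 < Num.sqrt (p%:R : R) by rewrite sqrtr_gt0 ltr0n.
rewrite ltr_pdivlMr ?mulr_gt0 ?ltr0n // => lt1.
have : ((a * c) ^ 2 * p < b ^ 2)%N.
  rewrite -(ltr_nat R) natrM !natrX natrM -[p%:R]sqr_sqrtr ?ler0n // -!exprMn.
  by rewrite ltr_pXn2r ?nnegrE ?mulr_ge0 ?ler0n ?ltW // -mulrA.
rewrite -(ltr_nat algC) natrM !natrX natrM -[p%:R]sqrtCK -!exprMn => lt2.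
by rewrite mulrA -(@ltr_pXn2r _ 2) ?sqrtCK ?nnegrE ?mulr_ge0 ?ler0n ?sqrtC_ge0 ?ler0n.
Qed.

Theorem theorem1p1 (R : rcfType) (p k : nat) :
  prime p -> (3 < p)%N -> (2 <= k)%N ->
  (k * 2 ^ (k - 1))%:R < (totient p.-1)%:R / ((W p.-1)%:R * Num.sqrt (p%:R : R)) ->
  forall A B : {set 'F_p}, (2 <= #|A|)%N -> #|B| = k ->
    sumset A B != primitive_elts p.
Proof.
move=> pr_p p3 k2 hyp A B _ cardB; apply/eqP => sumE.
have p1 : (0 < p.-1)%N by rewrite -subn1 subn_gt0 prime_gt1.
have W0 : (0 < W p.-1)%N by apply: leq_trans (leq_exp_primes_W p1); rewrite expn_gt0.
have {}hyp := sqrt_bound_algC W0 (prime_gt0 pr_p) hyp.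
pose other b := odflt 0 [pick b' in B :\ b].
have otherP b : b \in B -> other b \in B /\ other b != b.
  move=> bB; rewrite /other; case: pickP => [b'|none].
    by rewrite !inE => /andP[-> ->].
  have := cardsD1 b B; rewrite bB cardB (eq_card0 none) => k1.
  by rewrite k1 in k2.
(* Different b may give the same difference, so |C| can be less than k. *)
pose C := undup [seq other b - b | b <- enum B].
have C0 : 0 \notin C.
  rewrite mem_undup; apply/mapP => -[b]; rewrite mem_enum => /otherP[_ nb] /eqP.
  by rewrite eq_sym subr_eq0 (negPf nb).
have szC : (size C <= k)%N.
  by rewrite -cardB cardE -(size_map (fun b => other b - b)); apply: size_undup.
have [|x xP shift] := @exists_square_shift p pr_p p3 C (undup_uniq _) C0.
  (* With m = |C| <= k, 2^m m <= 2 * k 2^(k-1). *)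
  apply: le_lt_trans (_ : _ <= (k * 2 ^ (k - 1))%:R * ((W p.-1)%:R * sqrtC p%:R) *+ 2) _.
    rewrite -mulrnAl ler_wpM2r ?mulr_ge0 ?ler0n ?sqrtC_ge0 //.
    rewrite -[_ *+ 2]mulr_natr -natrM ler_nat -mulnA -expnSr subn1 prednK ?(ltnW k2) //.
    by rewrite mulnC leq_mul // leq_exp2l.
  by rewrite ltr_pMn2r.
have : x \in sumset A B by rewrite sumE.
case/imset2P => a b aA bB xE; have [oB ob] := otherP b bB.
have /shift/negP[] : other b - b \in C by rewrite mem_undup; apply: map_f; rewrite mem_enum.
by rewrite -sumE xE addrACA subrr addr0; apply: imset2_f.
Qed.
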